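(* There exists a constant $c_0>0$ such that the following holds. Let $f:\mathbb Z^2\to\mathbb R$ be a random field with law $\mathrm P$ which is translation invariant (T), reflection invariant (R), satisfies the FKG inequality (FKG), and satisfies the decoupling condition with a decay rate $\varepsilon(\cdot)$ such that $$\varepsilon(w,h,r)\le c_1\big(wh+(w+h)r+r^2\big)r^{-c_0}$$ for some $c_1>0$. Then there exist $c_2>0$ and $\xi>0$ such that, if $\delta\le c_2$, the random walk $(X_n)_{n\in\mathbb N}$ on the environment $f$ with parameter $\delta\in[0,1/2]$ satisfies $$\inf_{n\ge1}\mathbb P\big(|X_n|\ge n^{\xi}\big)>0 .$$
   Context: The random walk: given a realization of $f$ and $\delta\in[0,1/2]$, $X_0=0$ and $(X_n)_{n\ge 0}$ is the Markov process on $\mathbb Z$ with $\mathbb P^f(X_{n+1}=x+1\mid X_n=x)=1-\mathbb P^f(X_{n+1}=x-1\mid X_n=x)=\frac12+\delta\big(\mathbf 1_{\{f(x,n)>0\}}-\mathbf 1_{\{f(x,n)<0\}}\big)$. $\mathbb P$ is the annealed law (average of $\mathbb P^f$ over $f\sim\mathrm P$). (T): for every $(x_0,y_0)\in\mathbb Z^2$, the fields $(f(x,y))_{(x,y)\in\mathbb Z^2}$ and $(f(x+x_0,y+y_0))_{(x,y)\in\mathbb Z^2}$ have the same law. (R): $(f(x,y))_{(x,y)\in\mathbb Z^2}$ and $(f(-x,y))_{(x,y)\in\mathbb Z^2}$ have the same law. (FKG): an event $A$ is increasing if $f\le\tilde f$ (pointwise) and $f\in A$ imply $\tilde f\in A$;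 for all increasing events $A,B$, $\mathrm P(f\in A\cap B)\ge\mathrm P(f\in A)\,\mathrm P(f\in B)$. Decoupling condition with decay rate $\varepsilon(\cdot)$: for every integer $r\ge2$ and every rectangle $C=[a,a+w]\times[b,b+h]\subset\mathbb Z^2$ with $w,h\ge1$, there is a coupling between $f$ and a field $f^{C,r}$ such that $\mathrm P(f^{C,r}\ne f)\le\varepsilon(w,h,r)$ and, for any sets $A\subset C$ and $B\subset\mathbb Z^2$ with $d(A,B)>r$ ($d$ is the $L^1$-distance on $\mathbb Z^2$), the restrictions $f^{C,r}|_A$ and $f^{C,r}|_B$ are independent. *)

(* Defs.v *)
From HB Require Import structures.
From mathcomp Require Import all_boot all_order all_algebra.
From mathcomp Require Import all_classical all_reals all_analysis.

Set Implicit Arguments.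
Unset Strict Implicit.
Unset Printing Implicit Defensive.

Import Order.TTheory GRing.Theory Num.Theory.
Import numFieldNormedType.Exports.

Local Open Scope classical_set_scope.
Local Open Scope ring_scope.

Definition Z2 : Type := (int * int)%type.

(* One-dimensional cylinders on the sites of A: <<s cylinders A >> is the
   sigma-algebra of the events that depend on the restriction of f to A only. *)
Definition cylinders (R : realType) (A : set Z2) : set (set (Z2 -> R)) :=
  [set E | exists2 z : Z2, A z &
    exists2 B : set (measurableTypeR R), measurable B & E = [set f | B (f z)]].

(* Realizations of the field, with the product sigma-algebra of R^(Z^2); a
   random field is given by its law, a probability on this space. *)
Definition field_space (R : realType) :=
  g_sigma_algebraType (@cylinders R [set: Z2]).

Definition shift_field (R : realType) (v : Z2) (f : field_space R) :
    field_space R :=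
  fun z => f (z.1 + v.1, z.2 + v.2).

Definition reflect_field (R : realType) (f : field_space R) : field_space R :=
  fun z => f (- z.1, z.2).

Definition translation_invariant (R : realType)
    (P : probability (field_space R) R) : Prop :=
  forall (v : Z2) (E : set (field_space R)), measurable E ->
    pushforward P (shift_field v) E = P E.

Definition reflection_invariant (R : realType)
    (P : probability (field_space R) R) : Prop :=
  forall E : set (field_space R), measurable E ->
    pushforward P (@reflect_field R) E = P E.

Definition increasing_event (R : realType) (E : set (field_space R)) : Prop :=
  forall f g : field_space R, (forall z : Z2, f z <= g z) -> E f -> E g.

Definition FKG (R : realType) (P : probability (field_space R) R) : Prop :=
  forall A B : set (field_space R), measurable A -> measurable B ->
    increasing_event A -> increasing_event B ->
    (P A * P B <= P (A `&` B))%E.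

Definition rectangle (a b : int) (w h : nat) : set Z2 :=
  [set z | (a <= z.1 <= a + w%:Z) && (b <= z.2 <= b + h%:Z)].

Definition l1_dist (z z' : Z2) : int := `|z.1 - z'.1| + `|z.2 - z'.2|.

(* The infimum is +oo when A or B is empty. *)
Definition set_dist (R : realType) (A B : set Z2) : \bar R :=
  ereal_inf [set ((l1_dist z z')%:~R)%:E | z in A & z' in B].

Definition independent_restrictions (R : realType)
    (mu : set (field_space R) -> \bar R) (A B : set Z2) : Prop :=
  forall E F : set (field_space R),
    <<s @cylinders R A >> E -> <<s @cylinders R B >> F ->
    mu (E `&` F) = (mu E * mu F)%E.

(* [nu] is the joint law of (f, f^{C,r}); only its first marginal is
   prescribed. *)
Definition decoupling (R : realType) (P : probability (field_space R) R)
    (eps : nat -> nat -> nat -> R) : Prop :=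
  forall (r : nat) (a b : int) (w h : nat),
    (2 <= r)%N -> (1 <= w)%N -> (1 <= h)%N ->
    exists nu : probability (field_space R * field_space R)%type R,
      [/\ (forall E : set (field_space R), measurable E ->
             pushforward nu fst E = P E),
          (nu [set p | p.2 <> p.1] <= (eps w h r)%:E)%E &
          forall A B : set Z2, A `<=` rectangle a b w h ->
            (r%:R%:E < set_dist R A B)%E ->
            independent_restrictions (pushforward nu snd) A B].

Definition up_prob (R : realType) (delta : R) (f : field_space R) (x : int)
    (n : nat) : R :=
  2^-1 + delta * ((0 < f (x, n%:Z))%R%:R - (f (x, n%:Z) < 0)%R%:R).

Definition transition (R : realType) (delta : R) (f : field_space R) (n : nat)
    (x y : int) : R :=
  if y == x + 1 then up_prob delta f x n
  else if y == x - 1 then 1 - up_prob delta f x n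
  else 0.

(* Under Q, (X n) is a Markov process started at 0 with transition
   probabilities [transition delta f n] at time n; the conditional probability
   given the history is multiplied out by the probability of the history. *)
Definition quenched_walk (R : realType) (delta : R) (f : field_space R)
    (d : measure_display) (Omega : measurableType d) (Q : probability Omega R)
    (X : nat -> Omega -> int) : Prop :=
  [/\ (forall (n : nat) (x : int), measurable [set om | X n om = x]),
      Q [set om | X 0%N om = 0] = 1%E &
      forall (n : nat) (x : nat -> int),
        Q [set om | forall i : nat, (i <= n.+1)%N -> X i om = x i] =
        (Q [set om | forall i : nat, (i <= n)%N -> X i om = x i] *
           (transition delta f n (x n) (x n.+1))%:E)%E].

Definition annealed (R : realType) (P : probability (field_space R) R)
    (d : measure_display) (Omega : measurableType d)
    (Pf : field_space R -> probability Omega R) (E : set Omega) : \bar R :=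
  (\int[P]_f Pf f E)%E.

(* Main.v *)
Require Import Defs.
From HB Require Import structures.
From mathcomp Require Import all_boot all_order all_algebra.
From mathcomp Require Import all_classical all_reals all_analysis.
From mathcomp Require Import measurable_realfun ring lra zify.
Set Implicit Arguments.
Unset Strict Implicit.
Unset Printing Implicit Defensive.
Import Order.TTheory GRing.Theory Num.Theory.
Import numFieldNormedType.Exports.
Local Open Scope classical_set_scope.
Local Open Scope ring_scope.

(** Cut the time n into eight blocks of length l, each followed by a gap whose
    length g is a small power of n.  By decoupling, the fields seen in distinct
    blocks are independent up to an error polynomially small in g.  During a
    gap, however, the walk sees a field correlated with both neighbouring
    blocks, so the point at which it enters a block may depend on the field in
    that block.

    Monotonicity removes this dependence.  Nearest-neighbour walks in a common
    field can be coupled so as not to cross, hence the walk lies between the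
    two auxiliary walks that use the field in the blocks only and that go
    deterministically up, respectively down, during the gaps.  An auxiliary
    walk enters each block at a point determined by the earlier blocks, so by
    translation invariance its increments are nearly independent with the law
    of X_l shifted by g or by -g.  The two walks are ordered and their mean
    positions differ by sixteen times g only, however far apart they could be;
    hence the walk is within order g of each of them in L1
    ([ev_block_walk_dist], [mean_block_walk], [walk_mean_comparison]).

    It follows that the characteristic function of X_n at the frequency t has
    the modulus of the eighth power of that of X_l, up to an error of order
    t g.  Suppose that |phi_l(t)|^2 <= 1/2.  Symmetrization and the inequality
    1 - cos (x / 2) >= (1 - cos x) / 4 give |phi_l(t / 2)|^2 <= 7/8, and
    (7/8)^8 < 1/2 leaves room for the error: |phi_n(t / 2)|^2 <= 1/2
    ([spread_step]).  The frequency is halved while the time is multiplied by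
    at most 16, so this propagates the bound at a frequency of order n^(-1/4)
    to all scales.  The induction starts on a range of times over which delta
    is so small that the walk is a perturbation of the simple random walk
    ([char_sq_base]); this is what determines c2.  Finally, a characteristic
    function that is far from 1 in modulus at the frequency 1 / M forces
    |X_n| >= M / 2 with a probability bounded below ([spread_walk_mean]), and
    the finitely many remaining times are covered by the event that the walk
    always goes up. *)

(** * Trigonometric inequalities *)

Section Trig.
Variable R : realType.
Implicit Types x y : R.

Lemma sin_lipschitz x y : `|sin x - sin y| <= `|x - y|.
Proof.
wlog xy : x y / y <= x.
  by move=> H; case: (leP y x) => [/H//|/ltW/H]; rewrite distrC (distrC y).
have [c _ ->] : exists2 c, c \in `[y, x]%R & sin x - sin y = cos c * (x - y).
  apply: (MVT_segment xy).
  exact/continuous_subspaceT/continuous_sin.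
by rewrite normrM -[leRHS]mul1r ler_wpM2r // cos_max.
Qed.

Lemma cos_lipschitz x y : `|cos x - cos y| <= `|x - y|.
Proof.
wlog xy : x y / y <= x.
  by move=> H; case: (leP y x) => [/H//|/ltW/H]; rewrite distrC (distrC y).
have [c _ ->] : exists2 c, c \in `[y, x]%R & cos x - cos y = - sin c * (x - y).
  apply: (MVT_segment (df := fun z => - sin z) xy).
  exact/continuous_subspaceT/continuous_cos.
by rewrite normrM normrN -[leRHS]mul1r ler_wpM2r // sin_max.
Qed.

Lemma one_sub_cos x : 1 - cos x = 2 * sin (x / 2) ^+ 2.
Proof.
have -> : cos x = cos (x / 2 *+ 2) by congr cos; rewrite -mulr_natr; field.
rewrite cos_mulr2n sin2cos2 -mulr_natr; ring.
Qed.

Lemma cos_ge_quadratic x : 1 - x ^+ 2 / 2 <= cos x.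
Proof.
have := sin_lipschitz (x / 2) 0; rewrite sin0 !subr0 => s.
have : `|sin (x / 2)| ^+ 2 <= `|x / 2| ^+ 2 by rewrite lerXn2r ?nnegrE.
rewrite !real_normK ?num_real // expr_div_n.
by have := one_sub_cos x; lra.
Qed.

Lemma cos_le_quadratic x : 0 <= x <= 1 -> cos x <= 1 - x ^+ 2 / 4.
Proof.
move=> /andP[x0 x1].
have x20 : 0 <= x / 2 by lra.
have [c c01 sE] : exists2 c, c \in `[0, x / 2]%R &
    sin (x / 2) - sin 0 = cos c * (x / 2 - 0).
  apply: (MVT_segment x20).
  exact/continuous_subspaceT/continuous_sin.
rewrite sin0 !subr0 in sE.
move: c01; rewrite in_itv /= => /andP[c0 c1].
have cc : 7 / 8 <= cos c by have := cos_ge_quadratic c; nra.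
have cc2 : 1 / 2 <= cos c ^+ 2 by nra.
have := one_sub_cos x; rewrite sE exprMn.
have : 1 / 2 * (x / 2) ^+ 2 <= cos c ^+ 2 * (x / 2) ^+ 2.
  by rewrite ler_wpM2r // sqr_ge0.
rewrite expr_div_n; lra.
Qed.

Lemma one_sub_cos_half x : (1 - cos x) / 4 <= 1 - cos (x / 2).
Proof.
have -> : 1 - cos x = 2 - 2 * cos (x / 2) ^+ 2.
  by rewrite one_sub_cos sin2cos2; ring.
by have := cos_le1 (x / 2); nra.
Qed.

(** The modulus of a characteristic function, through the difference of two
    independent copies. *)
Lemma char_fun_modulus (I : finType) (w : I -> R) (th : I -> R) :
  \sum_i w i = 1 ->
  1 - ((\sum_i w i * cos (th i)) ^+ 2 + (\sum_i w i * sin (th i)) ^+ 2) =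
  \sum_i \sum_j w i * w j * (1 - cos (th i - th j)).
Proof.
move=> w1.
have sq (a b : I -> R) : (\sum_i w i * a i) * (\sum_j w j * b j) =
    \sum_i \sum_j w i * w j * (a i * b j).
  rewrite mulr_suml; apply: eq_bigr => i _; rewrite mulr_sumr.
  by apply: eq_bigr => j _; ring.
have e1 : 1 = \sum_i \sum_j w i * w j * (1 * 1) :> R.
  rewrite -(sq (fun=> 1) (fun=> 1)).
  by under eq_bigr do rewrite mulr1; rewrite w1 mulr1.
rewrite [X in X - _]e1 !expr2 !sq -big_split /= -sumrB.
apply: eq_bigr => i _; rewrite -big_split /= -sumrB.
by apply: eq_bigr => j _; rewrite cosB; ring.
Qed.

(** Halving the frequency divides the defect of the modulus by four at most:
    the defect is an average of the terms 1 - cos, to which the duplication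
    formula applies. *)
Lemma char_fun_half (I : finType) (w : I -> R) (th : I -> R) :
  (forall i, 0 <= w i) -> \sum_i w i = 1 ->
  (1 - ((\sum_i w i * cos (th i)) ^+ 2 + (\sum_i w i * sin (th i)) ^+ 2)) / 4
  <= 1 - ((\sum_i w i * cos (th i / 2)) ^+ 2 +
          (\sum_i w i * sin (th i / 2)) ^+ 2).
Proof.
move=> w0 w1; rewrite !char_fun_modulus // mulr_suml; apply: ler_sum => i _.
rewrite mulr_suml; apply: ler_sum => j _.
have := ler_wpM2l (mulr_ge0 (w0 i) (w0 j)) (one_sub_cos_half (th i - th j)).
by rewrite mulrA mulrBl.
Qed.

End Trig.

(** * Quenched expectations and monotonicity *)

(** Backward recursion for the expectation of u at time s + n of the walk that
    is at x at time s and goes up with probabilities p.  It is a finite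
    expression, so no space of trajectories is needed until the very end. *)
Fixpoint ev (R : realType) (p : int -> nat -> R) (n s : nat) (x : int)
    (u : int -> R) : R :=
  if n is n'.+1 then
    p x s * ev p n' s.+1 (x + 1) u + (1 - p x s) * ev p n' s.+1 (x - 1) u
  else u x.

(** Monotonicity along the points of a given parity.  The walk alternates
    between the two parities, and two walks started at adjacent points do cross,
    so this is the notion of monotonicity that one step preserves. *)
Definition step2_monotone (R : realType) (u : int -> R) : Prop :=
  forall x, u x <= u (x + 2).

(** The auxiliary walk that follows p during k blocks of length l and makes the
    deterministic displacement h during the gap of length g after each of
    them. *)
Fixpoint block_walk (R : realType) (p : int -> nat -> R) (l g : nat) (h : int)
    (k s : nat) (x : int) (u : int -> R) : R :=
  if k is k'.+1 then
    ev p l s x (fun y => block_walk p l g h k' (l + g + s)%N (y + h) u)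
  else u x.

Section Walk.
Variables (R : realType) (p : int -> nat -> R).

Lemma evD n s x u v :
  ev p n s x (fun y => u y + v y) = ev p n s x u + ev p n s x v.
Proof. by elim: n s x => [|n IH] s x //=; rewrite !IH; ring. Qed.

Lemma evZ n s x a u : ev p n s x (fun y => a * u y) = a * ev p n s x u.
Proof. by elim: n s x => [|n IH] s x //=; rewrite !IH; ring. Qed.

Lemma evB n s x u v :
  ev p n s x u - ev p n s x v = ev p n s x (fun y => u y - v y).
Proof. by elim: n s x => [|n IH] s x //=; rewrite -!IH; ring. Qed.

Lemma ev_cst n s x c : ev p n s x (fun=> c) = c.
Proof. by elim: n s x => [|n IH] s x //=; rewrite !IH; ring. Qed.

Lemma ev_sum (I : Type) (r : seq I) n s x (u : I -> int -> R) :
  ev p n s x (fun y => \sum_(i <- r) u i y) = \sum_(i <- r) ev p n s x (u i).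
Proof.
elim: r => [|i r IH].
  by rewrite big_nil -[RHS](ev_cst n s x); congr ev; apply/funext => y; rewrite big_nil.
rewrite big_cons -IH -evD; congr ev; apply/funext => y; exact: big_cons.
Qed.

Lemma ev_add a b s x u :
  ev p (a + b) s x u = ev p a s x (fun y => ev p b (a + s)%N y u).
Proof.
elim: a s x => [|a IH] s x //=; rewrite !IH.
by under [in RHS]eq_fun do rewrite addSnnS.
Qed.

Lemma ev_eq n s x u v : (forall y, `|y - x| <= n%:Z -> u y = v y) ->
  ev p n s x u = ev p n s x v.
Proof.
elim: n s x => [|n IH] s x uv /=; first by apply: uv; lia.
by rewrite (IH s.+1 (x + 1)) ?(IH s.+1 (x - 1)) // => y ?; apply: uv; lia.
Qed.

Hypothesis p01 : forall x s, 0 <= p x s <= 1.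

Lemma ev_le n s x u v : (forall y, `|y - x| <= n%:Z -> u y <= v y) ->
  ev p n s x u <= ev p n s x v.
Proof.
elim: n s x => [|n IH] s x uv /=; first by apply: uv; lia.
have /andP[p0 p1] := p01 x s.
apply: lerD; (apply: ler_wpM2l; first by rewrite ?subr_ge0); apply: IH => y ?;
  apply: uv; lia.
Qed.

Lemma ev_norm n s x u B : (forall y, `|y - x| <= n%:Z -> `|u y| <= B) ->
  `|ev p n s x u| <= B.
Proof.
move=> uB; rewrite ler_norml; apply/andP; split.
  rewrite -[leLHS](ev_cst n s x).
  by apply: ev_le => y /uB; rewrite ler_norml => /andP[].
rewrite -[leRHS](ev_cst n s x).
by apply: ev_le => y /uB; rewrite ler_norml => /andP[].
Qed.

(** This is the absence of crossings: one step from x stays below x + 1, and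
    one step from x + 2 stays above it. *)
Lemma ev_step2_monotone n s u : step2_monotone u ->
  step2_monotone (fun x => ev p n s x u).
Proof.
move=> mu; elim: n s => [|n IH] s x /=; first exact: mu.
have /andP[p0 p1] := p01 x s; have /andP[q0 q1] := p01 (x + 2) s.
set w := fun x => ev p n s.+1 x u; have mw : step2_monotone w := IH s.+1.
have h1 := mw (x - 1); have h2 := mw (x + 1).
rewrite -/(w (x + 1)) -/(w (x - 1)) -/(w (x + 2 + 1)) -/(w (x + 2 - 1)).
have -> : x + 2 - 1 = x + 1 by ring.
have -> : x + 2 + 1 = x + 1 + 2 by ring.
have e : x - 1 + 2 = x + 1 by ring.
rewrite e in h1.
apply: (@le_trans _ _ (w (x + 1))); first by nra.
by nra.
Qed.

Lemma ev_le_up g s x u : step2_monotone u -> ev p g s x u <= u (x + g%:Z).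
Proof.
move=> mu; elim: g s x => [|g IH] s x /=; first by rewrite addr0.
have /andP[p0 p1] := p01 x s.
have h1 := IH s.+1 (x + 1); have h2 := IH s.+1 (x - 1).
have h3 := mu (x - 1 + g%:Z).
have e1 : x - 1 + g%:Z + 2 = x + g.+1%:Z by lia.
have e2 : x + 1 + g%:Z = x + g.+1%:Z by lia.
rewrite e1 in h3; rewrite e2 in h1; nra.
Qed.

Lemma ev_ge_down g s x u : step2_monotone u -> u (x - g%:Z) <= ev p g s x u.
Proof.
move=> mu; elim: g s x => [|g IH] s x /=; first by rewrite subr0.
have /andP[p0 p1] := p01 x s.
have h1 := IH s.+1 (x + 1); have h2 := IH s.+1 (x - 1).
have h3 := mu (x - g.+1%:Z).
have e1 : x - g.+1%:Z + 2 = x + 1 - g%:Z by lia.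
have e2 : x - 1 - g%:Z = x - g.+1%:Z by lia.
rewrite e1 in h3; rewrite e2 in h2; nra.
Qed.

Lemma block_walkD l g h k s x u v :
  block_walk p l g h k s x (fun y => u y + v y) =
  block_walk p l g h k s x u + block_walk p l g h k s x v.
Proof.
elim: k s x => [|k IH] s x //=; rewrite -evD; congr ev.
by apply/funext => y; rewrite IH.
Qed.

Lemma block_walkZ l g h k s x a u :
  block_walk p l g h k s x (fun y => a * u y) =
  a * block_walk p l g h k s x u.
Proof.
elim: k s x => [|k IH] s x //=; rewrite -evZ; congr ev.
by apply/funext => y; rewrite IH.
Qed.

Lemma ev_le_block_walk l g k s x u : step2_monotone u ->
  ev p (k * (l + g)) s x u <= block_walk p l g g%:Z k s x u.
Proof.
move=> mu; elim: k s x => [|k IH] s x //=.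
rewrite mulSn -addnA ev_add; apply: ev_le => y _.
rewrite ev_add; apply: (le_trans (ev_le_up _ _ _ _)).
  exact: ev_step2_monotone.
by rewrite addnA (addnC g); exact: IH.
Qed.

Lemma ev_ge_block_walk l g k s x u : step2_monotone u ->
  block_walk p l g (- g%:Z) k s x u <= ev p (k * (l + g)) s x u.
Proof.
move=> mu; elim: k s x => [|k IH] s x //=.
rewrite mulSn -[(l + g + k * _)%N]addnA ev_add; apply: ev_le => y _.
rewrite ev_add; apply: (le_trans _ (ev_ge_down _ _ _ _)); last first.
  exact: ev_step2_monotone.
by rewrite addnA (addnC g); exact: IH.
Qed.

Lemma block_walk_norm l g h k s x u B : `|h| <= g%:Z ->
  (forall y, `|y - x| <= (k * (l + g))%N%:Z -> `|u y| <= B) ->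
  `|block_walk p l g h k s x u| <= B.
Proof.
move=> hg; elim: k s x => [|k IH] s x uB /=; first by apply: uB; lia.
by apply: ev_norm => y yx; apply: IH => z zy; apply: uB; nia.
Qed.

(** A function u whose increments over two steps are at most 2 tau is sandwiched
    by monotone functions: both tau id + u and tau id - u are monotone, so the
    distance between the expectations of u is controlled by the distance between
    the mean positions of the two extreme walks. *)
Lemma ev_block_walk_dist l g k s x (u : int -> R) tau : 0 <= tau ->
  (forall y, `|u (y + 2) - u y| <= 2 * tau) ->
  `|ev p (k * (l + g)) s x u - block_walk p l g g%:Z k s x u| <=
    tau * (block_walk p l g g%:Z k s x intr -
           block_walk p l g (- g%:Z) k s x intr).
Proof.
move=> tau0 uL.
have mid : step2_monotone (intr : int -> R) by move=> y; rewrite ler_int; lia.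
have mp : step2_monotone (fun y => u y + tau * y%:~R).
  by move=> y; have := uL y; rewrite ler_norml intrD => /andP[? ?]; lra.
have mm : step2_monotone (fun y => (-1) * u y + tau * y%:~R).
  by move=> y; have := uL y; rewrite ler_norml intrD => /andP[? ?]; lra.
have := ev_ge_block_walk l g k s x mid.
have := ev_le_block_walk l g k s x mp.
have := ev_le_block_walk l g k s x mm.
rewrite !evD !block_walkD !evZ !block_walkZ ler_norml.
move=> h1 h2 h3; have := ler_wpM2l tau0 h3 => h4.
by apply/andP; split; lra.
Qed.

End Walk.

(** * Means of bounded functions of the field *)

Definition bounded_measurable d (T : measurableType d) (R : realType)
    (F : T -> R) : Prop :=
  measurable_fun setT F /\ exists B : R, forall x, `|F x| <= B.

Section Mean.
Context d (T : measurableType d) (R : realType) (mu : probability T R).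
Implicit Types F G : T -> R.

Lemma bounded_measurable_integrable F : bounded_measurable F ->
  mu.-integrable setT (EFin \o F).
Proof.
move=> [mF [B FB]]; apply: measurable_bounded_integrable => //.
  by rewrite (le_lt_trans (probability_le1 _ _)) ?ltry.
exists B; split; first exact: num_real.
by move=> M BM x _; apply: (le_trans (FB x)); exact: ltW.
Qed.

Lemma bounded_measurableD F G : bounded_measurable F -> bounded_measurable G ->
  bounded_measurable (fun x => F x + G x).
Proof.
move=> [mF [B FB]] [mG [C GC]]; split; first exact: measurable_funD.
by exists (B + C) => x; apply: (le_trans (ler_normD _ _)); exact: lerD.
Qed.

Lemma bounded_measurableM F G : bounded_measurable F -> bounded_measurable G ->
  bounded_measurable (fun x => F x * G x).
Proof.
move=> [mF [B FB]] [mG [C GC]]; split; first exact: measurable_funM.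
by exists (B * C) => x; rewrite normrM; apply: ler_pM.
Qed.

Lemma bounded_measurable_cst (c : R) : bounded_measurable (fun _ : T => c).
Proof. by split => //; exists `|c|. Qed.

Lemma bounded_measurableZ a F : bounded_measurable F ->
  bounded_measurable (fun x => a * F x).
Proof. by apply: bounded_measurableM; exact: bounded_measurable_cst. Qed.

Lemma bounded_measurableB F G : bounded_measurable F -> bounded_measurable G ->
  bounded_measurable (fun x => F x - G x).
Proof.
move=> mF mG; under eq_fun do rewrite -mulN1r.
by apply: bounded_measurableD => //; exact: bounded_measurableZ.
Qed.

Lemma bounded_measurable_indic (E : set T) : measurable E ->
  bounded_measurable (\1_E : T -> R).
Proof.
move=> mE; split; first exact: measurable_indic.
by exists 1 => x; rewrite indicE ger0_norm ?ler0n // lern1; case: (_ \in _).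
Qed.

Lemma mean_cst (c : R) : \int[mu]_x c = c.
Proof.
have -> : \int[mu]_x c = c * fine (mu setT) by exact: Rintegral_cst.
by rewrite probability_setT mulr1.
Qed.

Lemma meanD F G : bounded_measurable F -> bounded_measurable G ->
  \int[mu]_x (F x + G x) = \int[mu]_x F x + \int[mu]_x G x.
Proof. by move=> *; apply: RintegralD => //; exact: bounded_measurable_integrable. Qed.

Lemma meanB F G : bounded_measurable F -> bounded_measurable G ->
  \int[mu]_x (F x - G x) = \int[mu]_x F x - \int[mu]_x G x.
Proof. by move=> *; apply: RintegralB => //; exact: bounded_measurable_integrable. Qed.

Lemma meanZ a F : bounded_measurable F ->
  \int[mu]_x (a * F x) = a * \int[mu]_x F x.
Proof. by move=> *; apply: RintegralZl => //; exact: bounded_measurable_integrable. Qed.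

Lemma mean_sum (I : Type) (r : seq I) (F : I -> T -> R) :
  (forall i, bounded_measurable (F i)) ->
  bounded_measurable (fun x => \sum_(i <- r) F i x) /\
  \int[mu]_x (\sum_(i <- r) F i x) = \sum_(i <- r) \int[mu]_x F i x.
Proof.
move=> mF; elim: r => [|i r [IHm IH]].
  have -> : (fun x => \sum_(i <- [::]) F i x) = (fun=> 0).
    by apply/funext => x; rewrite big_nil.
  by rewrite big_nil mean_cst; split => //; exact: bounded_measurable_cst.
have -> : (fun x => \sum_(j <- i :: r) F j x) =
    (fun x => F i x + \sum_(j <- r) F j x).
  by apply/funext => x; rewrite big_cons.
by rewrite big_cons -IH meanD //; split => //; exact: bounded_measurableD.
Qed.

Lemma mean_indic (E : set T) : measurable E ->
  \int[mu]_x (\1_E x : R) = fine (mu E).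
Proof. by move=> mE; rewrite /Rintegral integral_indic // setIT. Qed.

Lemma mean_le F G : bounded_measurable F -> bounded_measurable G ->
  (forall x, F x <= G x) -> \int[mu]_x F x <= \int[mu]_x G x.
Proof.
by move=> mF mG FG; apply: le_Rintegral => //; exact: bounded_measurable_integrable.
Qed.

Lemma mean_norm_le F B : bounded_measurable F -> (forall x, `|F x| <= B) ->
  `|\int[mu]_x F x| <= B.
Proof.
move=> mF FB; rewrite ler_norml; apply/andP; split.
  rewrite -(mean_cst (- B)); apply: mean_le => // [|x].
    exact: bounded_measurable_cst.
  by have := FB x; rewrite ler_norml => /andP[].
rewrite -[leRHS]mean_cst; apply: mean_le => // [|x].
  exact: bounded_measurable_cst.
by have := FB x; rewrite ler_norml => /andP[].
Qed.

Lemma mean_norm F G : bounded_measurable F -> bounded_measurable G ->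
  (forall x, `|F x| <= G x) -> `|\int[mu]_x F x| <= \int[mu]_x G x.
Proof.
move=> mF mG FG; rewrite ler_norml; apply/andP; split.
  rewrite -mulN1r -meanZ //; apply: mean_le => // [|x].
    exact: bounded_measurableZ.
  by have := FG x; rewrite mulN1r ler_norml => /andP[].
by apply: mean_le => // x; have := FG x; rewrite ler_norml => /andP[].
Qed.

End Mean.

(** Linear combinations of indicators of events that depend on the field in A
    only.  This class contains every expectation of the quenched walk, and on
    it the independence of events extends to functions by bilinearity, without
    any approximation argument. *)
Inductive simple_on (R : realType) (A : set Z2) : (field_space R -> R) -> Prop :=
| simple_on_indic (E : set (field_space R)) :
    <<s @cylinders R A >> E -> simple_on A (\1_E : field_space R -> R)
| simple_onD F G : simple_on A F -> simple_on A G ->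
    simple_on A (fun f => F f + G f)
| simple_onZ a F : simple_on A F -> simple_on A (fun f => a * F f).

Section Simple.
Variable R : realType.
Implicit Types (A B : set Z2) (F G : field_space R -> R).

Lemma simple_on_cst A c : simple_on A (fun=> c : R).
Proof.
have -> : (fun=> c) = (fun f : field_space R => c * \1_setT f).
  by apply/funext => f; rewrite indicT mulr1.
apply: simple_onZ; apply: simple_on_indic.
have := @sigma_algebraCD _ setT (@cylinders R A) set0 (@sigma_algebra0 _ _ _).
by rewrite setTD setC0.
Qed.

Lemma simple_onW A B F : A `<=` B -> simple_on A F -> simple_on B F.
Proof.
move=> AB; elim => [E AE|{}F G _ IF _ IG|a {}F _ IF].
- apply: simple_on_indic; apply: sub_sigma_algebra2 AE.
  by move=> X [z Az ?]; exists z => //; exact: AB.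
- exact: simple_onD.
- exact: simple_onZ.
Qed.

Lemma cylinders_setI A (E E' : set (field_space R)) :
  <<s @cylinders R A >> E -> <<s @cylinders R A >> E' ->
  <<s @cylinders R A >> (E `&` E').
Proof.
have [_ _ _ +] := (sigma_algebraP (fun X (_ : <<s @cylinders R A >> X) =>
  @subsetT _ X)).1 (@smallest_sigma_algebra _ _ _).
exact.
Qed.

Lemma simple_onM A F G : simple_on A F -> simple_on A G ->
  simple_on A (fun f => F f * G f).
Proof.
elim => [E AE|{}F F' _ IF _ IF'|a {}F _ IF] AG.
- elim: AG => [E' AE'|{}G G' _ IG _ IG'|a {}G _ IG].
  + have -> : (fun f => \1_E f * \1_E' f) = \1_(E `&` E') :> (field_space R -> R).
      by rewrite indicI.
    by apply: simple_on_indic; exact: cylinders_setI.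
  + under eq_fun do rewrite mulrDr.
    exact: simple_onD.
  + under eq_fun do rewrite mulrCA.
    exact: simple_onZ.
- under eq_fun do rewrite mulrDl.
    apply: simple_onD; [exact: IF|exact: IF'].
- under eq_fun do rewrite -mulrA.
    apply: simple_onZ; exact: IF.
Qed.

Lemma cylinders_measurable A (E : set (field_space R)) :
  <<s @cylinders R A >> E -> measurable E.
Proof. by apply: sub_sigma_algebra2 => X [z Az ?]; exists z. Qed.

Lemma simple_on_bounded_measurable A F : simple_on A F -> bounded_measurable F.
Proof.
elim => [E AE|{}F F' _ IF _ IF'|a {}F _ IF].
- by apply: bounded_measurable_indic; exact: cylinders_measurable AE.
- exact: bounded_measurableD.
- exact: bounded_measurableZ.
Qed.

Lemma bounded_measurable_comp d (T : measurableType d)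
    (phi : T -> field_space R) F : measurable_fun setT phi ->
  bounded_measurable F -> bounded_measurable (F \o phi).
Proof.
move=> mphi [mF [B FB]]; split; first exact: measurableT_comp.
by exists B => x; exact: FB.
Qed.

Lemma mean_comp A F d (T : measurableType d) (mu : probability T R)
    (phi : T -> field_space R) (P : probability (field_space R) R) :
  measurable_fun setT phi ->
  (forall E, measurable E -> mu (phi @^-1` E) = P E) ->
  simple_on A F -> \int[mu]_x F (phi x) = \int[P]_f F f.
Proof.
move=> mphi muP; elim => [E AE|{}F F' AF IF AF' IF'|a {}F AF IF].
- have mE := cylinders_measurable AE.
  transitivity (\int[mu]_x (\1_(phi @^-1` E) x : R)); first exact: eq_Rintegral.
  rewrite [RHS](mean_indic P mE) -muP // mean_indic //.
  by rewrite -[X in measurable X]setTI; exact: mphi.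
- have mF := simple_on_bounded_measurable AF.
  have mF' := simple_on_bounded_measurable AF'.
  rewrite [RHS]meanD // -IF -IF' [LHS]meanD //; exact: bounded_measurable_comp.
- have mF := simple_on_bounded_measurable AF.
  rewrite [RHS]meanZ // -IF [LHS]meanZ //; exact: bounded_measurable_comp.
Qed.

(** Both sides are bilinear in F and G, so it is enough to consider
    indicators. *)
Lemma mean_indep A B F G d (T : measurableType d) (mu : probability T R)
    (phi : T -> field_space R) :
  measurable_fun setT phi ->
  independent_restrictions (pushforward mu phi) A B ->
  simple_on A F -> simple_on B G ->
  \int[mu]_x (F (phi x) * G (phi x)) =
  \int[mu]_x F (phi x) * \int[mu]_x G (phi x).
Proof.
move=> mphi ind AF BG.
have mc C H : simple_on C H -> bounded_measurable (H \o phi).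
  move=> /simple_on_bounded_measurable; exact: bounded_measurable_comp.
elim: AF => [E AE|{}F F' AF IF AF' IF'|a {}F AF IF].
- elim: BG => [E' BE'|{}G G' BG IG BG' IG'|a {}G BG IG].
  + have mE := cylinders_measurable AE; have mE' := cylinders_measurable BE'.
    have mp X : measurable X -> measurable (phi @^-1` X).
      by move=> mX; rewrite -[X in measurable X]setTI; exact: mphi.
    have := ind _ _ AE BE'; rewrite /pushforward preimage_setI => e.
    transitivity (\int[mu]_x (\1_(phi @^-1` E `&` phi @^-1` E') x : R)).
      by apply: eq_Rintegral => x _; rewrite indicI.
    rewrite mean_indic; last by apply: measurableI; exact: mp.
    rewrite e fineM; [|exact: fin_num_measure (mp _ mE)|
                       exact: fin_num_measure (mp _ mE')].
    by rewrite -(mean_indic mu (mp _ mE)) -(mean_indic mu (mp _ mE')).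
  + have mE : bounded_measurable (\1_E \o phi : T -> R).
      exact: mc (simple_on_indic AE).
    rewrite meanD; [|exact: (mc _ _ BG)|exact: (mc _ _ BG')].
    rewrite mulrDr -IG -IG' -meanD;
      [|by apply: bounded_measurableM => //; exact: (mc _ _ BG)
       |by apply: bounded_measurableM => //; exact: (mc _ _ BG')].
    by apply: eq_Rintegral => x _; rewrite mulrDr.
  + have mE : bounded_measurable (\1_E \o phi : T -> R).
      exact: mc (simple_on_indic AE).
    rewrite meanZ; last exact: (mc _ _ BG).
    rewrite mulrCA -IG -meanZ;
      last by apply: bounded_measurableM => //; exact: (mc _ _ BG).
    by apply: eq_Rintegral => x _; rewrite mulrCA.
- have mG := mc _ _ BG.
  rewrite meanD; [|exact: (mc _ _ AF)|exact: (mc _ _ AF')].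
  rewrite mulrDl -IF -IF' -meanD;
    [|by apply: bounded_measurableM => //; exact: (mc _ _ AF)
     |by apply: bounded_measurableM => //; exact: (mc _ _ AF')].
  by apply: eq_Rintegral => x _; rewrite mulrDl.
- have mG := mc _ _ BG.
  rewrite meanZ; last exact: (mc _ _ AF).
  rewrite -mulrA -IF -meanZ;
    last by apply: bounded_measurableM => //; exact: (mc _ _ AF).
  by apply: eq_Rintegral => x _; rewrite mulrA.
Qed.

End Simple.

(** * Decoupling for functions of the field *)

Section Field.
Variable R : realType.

Lemma field_coord_measurable (z : Z2) :
  measurable_fun setT (fun f : field_space R => f z : measurableTypeR R).
Proof.
move=> _ Y mY; rewrite setTI; apply: sub_sigma_algebra.
by exists z => //; exists Y.
Qed.

Lemma measurable_to_field d (T : measurableType d) (phi : T -> field_space R) :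
  (forall z, measurable_fun setT (fun x => phi x z : measurableTypeR R)) ->
  measurable_fun setT phi.
Proof.
move=> mphi.
apply: (@measurability _ _ T (field_space R) setT phi (@cylinders R setT) erefl).
move=> _ [_ [z _ [Y mY ->]] <-].
rewrite setTI; have := mphi z measurableT Y mY; rewrite setTI; exact.
Qed.

Lemma measurable_shift_field (v : Z2) :
  measurable_fun setT (@shift_field R v).
Proof. by apply: measurable_to_field => z; exact: field_coord_measurable. Qed.

(** Two fields differ if they differ at one of countably many sites. *)
Lemma measurable_field_neq :
  measurable [set p : field_space R * field_space R | p.2 <> p.1].
Proof.
have -> : [set p : field_space R * field_space R | p.2 <> p.1] =
    \bigcup_(z in [set: Z2]) [set p | p.2 z - p.1 z <> 0].
  apply/seteqP; split=> [p /= p21|p [z _] /=].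
    apply: contrapT => H; apply: p21; apply/funext => z; apply: contrapT => e.
    by apply: H; exists z => //= /eqP; rewrite subr_eq0 => /eqP.
  by move=> + p21; rewrite p21 subrr.
apply: countable_bigcupT_measurable => [|z]; first exact: countableP.
have mz : measurable_fun setT (fun p : field_space R * field_space R =>
    p.2 z - p.1 z : measurableTypeR R).
  apply: measurable_funB.
    exact: measurableT_comp (field_coord_measurable z) measurable_snd.
  exact: measurableT_comp (field_coord_measurable z) measurable_fst.
have := mz measurableT _ (measurableC (measurable_set1 (0 : R))).
by rewrite setTI.
Qed.

Lemma lt_set_dist (r : nat) (A B : set Z2) :
  (forall z z', A z -> B z' -> r%:Z + 1 <= l1_dist z z') ->
  (r%:R%:E < set_dist R A B)%E.
Proof.
move=> AB; apply: (@lt_le_trans _ _ ((r%:Z + 1)%:~R : R)%:E).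
  by rewrite lte_fin intrD ltrDl.
apply: le_ereal_inf_tmp => _ [z Az [z' Bz' <-]].
by rewrite lee_fin ler_int; exact: AB.
Qed.

(** Both functions are moved to the decoupled field, where they are
    independent, and back; each of the three moves costs twice the supremum of
    the function times the probability that the two fields differ. *)
Lemma decoupling_covariance (P : probability (field_space R) R) eps
    (r : nat) (a b : int) (w h : nat) (A B : set Z2) F G K :
  decoupling P eps -> (2 <= r)%N -> (1 <= w)%N -> (1 <= h)%N ->
  A `<=` rectangle a b w h ->
  (forall z z', A z -> B z' -> r%:Z + 1 <= l1_dist z z') ->
  simple_on A F -> simple_on B G ->
  (forall f, `|F f| <= 1) -> (forall f, `|G f| <= K) ->
  `|\int[P]_f (F f * G f) - \int[P]_f F f * \int[P]_f G f| <=
    6 * K * eps w h r.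
Proof.
move=> dec r2 w1 h1 AC AB AF BG F1 GK.
have [nu [nu1 nuD ind]] := dec r a b w h r2 w1 h1.
have {}ind := ind A B AC (lt_set_dist AB).
have m1 : measurable_fun setT (fst : field_space R * field_space R -> _).
  exact: measurable_fst.
have m2 : measurable_fun setT (snd : field_space R * field_space R -> _).
  exact: measurable_snd.
have K0 : 0 <= K by apply: le_trans (GK (fun=> 0)).
have TF := simple_onW (@subsetT _ A) AF.
have TG := simple_onW (@subsetT _ B) BG.
have bm C H phi : simple_on C H -> measurable_fun setT phi ->
    bounded_measurable (fun p : field_space R * field_space R => H (phi p)).
  by move=> /simple_on_bounded_measurable bH mphi; exact: (bounded_measurable_comp mphi bH).
(* The field and its decoupled copy differ with small probability only. *)
have close H C : simple_on setT H -> (forall f, `|H f| <= C) ->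
    `|\int[nu]_p H p.1 - \int[nu]_p H p.2| <= 2 * C * eps w h r.
  move=> sH HC; have C0 : 0 <= C by apply: le_trans (HC (fun=> 0)).
  have mD := measurable_field_neq.
  rewrite -meanB; [|exact: bm sH m1|exact: bm sH m2].
  apply: (@le_trans _ _ (\int[nu]_p (2 * C * \1_[set p | p.2 <> p.1] p))).
    apply: mean_norm => [||p].
    - by apply: bounded_measurableB; [exact: bm sH m1|exact: bm sH m2].
    - by apply: bounded_measurableZ; exact: bounded_measurable_indic.
    rewrite indicE; case: (pselect (p.2 = p.1)) => [->|ne].
      by rewrite subrr normr0 !mulr_ge0.
    rewrite mem_set //= mulr1 mulr_natl mulr2n.
    by apply: (le_trans (ler_normB _ _)); exact: lerD.
  rewrite meanZ; last exact: bounded_measurable_indic.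
  rewrite mean_indic //; apply: ler_wpM2l; first exact: mulr_ge0.
  rewrite -lee_fin fineK //; exact: fin_num_measure.
have PE H : simple_on setT H -> \int[P]_f H f = \int[nu]_p H p.1.
  by move=> sH; rewrite (mean_comp (P := P) m1 nu1 sH).
rewrite !PE //; last exact: simple_onM.
have e2 := mean_indep m2 ind AF BG.
have FGK f : `|F f * G f| <= K.
  by rewrite normrM -[K]mul1r; apply: ler_pM.
have cFG := close _ K (simple_onM TF TG) FGK.
have cF := close _ 1 TF F1.
have cG := close _ K TG GK.
have nF : `|\int[nu]_p F p.2| <= 1 by apply: mean_norm_le => //; exact: bm TF m2.
have nG : `|\int[nu]_p G p.1| <= K by apply: mean_norm_le => //; exact: bm TG m1.
rewrite e2 in cFG.
set x1 := \int[nu]_p F p.1 in cF *; set x2 := \int[nu]_p F p.2 in cF nF cFG.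
set y1 := \int[nu]_p G p.1 in cG nG *; set y2 := \int[nu]_p G p.2 in cG cFG.
set z := \int[nu]_p (F p.1 * G p.1) in cFG *.
have -> : z - x1 * y1 = (z - x2 * y2) - x2 * (y1 - y2) - (x1 - x2) * y1 by ring.
apply: (le_trans (ler_normB _ _)).
apply: (@le_trans _ _ (2 * K * eps w h r + 1 * (2 * K * eps w h r) +
    2 * 1 * eps w h r * K)); last by rewrite le_eqVlt; apply/orP; left; apply/eqP; ring.
apply: lerD; last by rewrite normrM; apply: ler_pM.
apply: (le_trans (ler_normB _ _)); apply: lerD => //.
by rewrite normrM; apply: ler_pM.
Qed.

Lemma simple_on_up_prob A (delta : R) x n : A (x, n%:Z) ->
  simple_on A (fun f => up_prob delta f x n).
Proof.
move=> Ax; rewrite /up_prob.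
have cyl (Y : set (measurableTypeR R)) : measurable Y ->
    simple_on A (\1_[set f : field_space R | Y (f (x, n%:Z))]).
  move=> mY; apply: simple_on_indic; apply: sub_sigma_algebra.
  by exists (x, n%:Z) => //; exists Y.
have -> : (fun f : field_space R => 2^-1 + delta *
    ((0 < f (x, n%:Z))%R%:R - (f (x, n%:Z) < 0)%R%:R)) =
  (fun f => 2^-1 + delta * (\1_[set f : field_space R | `]0, +oo[%classic (f (x, n%:Z))] f
    + (-1) * \1_[set f : field_space R | `]-oo, 0[%classic (f (x, n%:Z))] f)).
  apply/funext => f; rewrite !indicE !mulN1r.
  have -> : (f \in [set f : field_space R | `]0, +oo[%classic (f (x, n%:Z))]) =
      (0 < f (x, n%:Z)).
    by apply/idP/idP; rewrite inE /= in_itv /= andbT.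
  have -> : (f \in [set f : field_space R | `]-oo, 0[%classic (f (x, n%:Z))]) =
      (f (x, n%:Z) < 0).
    by apply/idP/idP; rewrite inE /= in_itv.
  by [].
apply: simple_onD; first exact: simple_on_cst.
apply: simple_onZ; apply: simple_onD; first exact: (cyl _ (measurable_itv _)).
by apply: simple_onZ; exact: (cyl _ (measurable_itv _)).
Qed.

(** Within n steps from (x, s) the walk explores a finite cone only.  The
    terminal function V may itself depend on the field: this is how the later
    blocks enter. *)
Lemma simple_on_ev A (delta : R) n s x (V : int -> field_space R -> R) :
  (forall z : Z2, `|z.1 - x| <= n%:Z -> s%:Z <= z.2 < s%:Z + n%:Z -> A z) ->
  (forall y, `|y - x| <= n%:Z -> simple_on A (V y)) ->
  simple_on A (fun f => ev (up_prob delta f) n s x (V^~ f)).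
Proof.
elim: n s x => [|n IH] s x cone AV /=; first by apply: AV; lia.
have Ap : simple_on A (fun f => up_prob delta f x s).
  by apply: simple_on_up_prob; apply: cone => /=; lia.
have AI y : `|y - x| <= 1 ->
    simple_on A (fun f => ev (up_prob delta f) n s.+1 y (V^~ f)).
  move=> yx; apply: IH => [z z1 z2|y' y'y]; first by apply: cone; lia.
  by apply: AV; lia.
apply: simple_onD; apply: simple_onM => //; try by apply: AI; lia.
have -> : (fun f => 1 - up_prob delta f x s) =
    (fun f => 1 + (-1) * up_prob delta f x s).
  by apply/funext => f; rewrite mulN1r.
apply: simple_onD; first exact: simple_on_cst.
exact: simple_onZ.
Qed.

Lemma simple_on_block_walk (delta : R) l g h k s x u :
  simple_on [set z : Z2 | s%:Z <= z.2]
    (fun f => block_walk (up_prob delta f) l g h k s x u).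
Proof.
elim: k s x => [|k IH] s x /=; first exact: simple_on_cst.
apply: simple_on_ev => [z _ /andP[]//|y _].
by apply: (simple_onW _ (IH _ _)) => z /=; lia.
Qed.

Lemma ev_shift (p : int -> nat -> R) n s m x y u :
  ev p n (m + s) (y + x) u =
  ev (fun y m => p (y + x) (m + s)%N) n m y (fun y => u (y + x)).
Proof.
elim: n m y => [|n IH] m y //=; rewrite -!IH addSn.
by rewrite (addrAC y x 1) (addrAC y x (- 1)).
Qed.

Lemma mean_ev_shift (P : probability (field_space R) R) delta n s x u :
  translation_invariant P ->
  \int[P]_f ev (up_prob delta f) n s x u =
  \int[P]_f ev (up_prob delta f) n 0 0 (fun y => u (y + x)).
Proof.
move=> tr.
have sF : simple_on setT
    (fun f => ev (up_prob delta f) n 0 0 (fun y => u (y + x))).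
  by apply: simple_on_ev => // y _; exact: simple_on_cst.
rewrite -(mean_comp (measurable_shift_field (x, s%:Z)) (tr _) sF).
apply: eq_Rintegral => f _.
rewrite -{1}[s]add0n -{1}[x]add0r ev_shift; congr ev.
Qed.

End Field.

(** * Independence of the blocks *)

(** The transition operator of the random walk on Z with independent increments
    distributed as the annealed law of the displacement in one block, plus h. *)
Definition mean_step (R : realType) (P : probability (field_space R) R)
    (delta : R) (l : nat) (h : int) (u : int -> R) (x : int) : R :=
  \int[P]_f ev (up_prob delta f) l 0 0 (fun y => u (y + x + h)).

Lemma up_prob01 (R : realType) (delta : R) : 0 <= delta <= 2^-1 ->
  forall f x n, 0 <= up_prob delta f x n <= 1.
Proof.
move=> d01 f x n; rewrite /up_prob.
by case: (ltgtP (f (x, n%:Z)) 0) => _ /=; rewrite ?mulr1n ?mulr0n; lra.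
Qed.

(** Expansion along the endpoint.  The endpoint is summed over, rather than the
    trajectory, to keep the number of terms linear in n: each of them will cost
    one decoupling error. *)
Lemma ev_kernel (R : realType) (p : int -> nat -> R) n s x (u : int -> R) :
  ev p n s x u =
  \sum_(i < n.*2.+1) ev p n s x (fun y => (y == x - n%:Z + i%:Z)%:R) *
    u (x - n%:Z + i%:Z).
Proof.
transitivity (ev p n s x (fun y => \sum_(i < n.*2.+1)
    u (x - n%:Z + i%:Z) * (y == x - n%:Z + i%:Z)%:R)).
  apply: ev_eq => y yx.
  set j0 : int := y - x + n%:Z.
  have iP : (absz j0 < n.*2.+1)%N by rewrite /j0; lia.
  rewrite (bigD1 (Ordinal iP)) //= big1 ?addr0; last first.
    move=> j /eqP ji; case: eqP => [yj|]; last by rewrite mulr0.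
    by case: ji; apply/val_inj => /=; rewrite /j0; lia.
  have -> : x - n%:Z + (absz j0)%:Z = y by rewrite /j0; lia.
  by rewrite eqxx mulr1.
by rewrite ev_sum; apply: eq_bigr => i _; rewrite evZ mulrC.
Qed.

Section Blocks.
Variables (R : realType) (P : probability (field_space R) R).
Variables (eps : nat -> nat -> nat -> R) (delta : R) (l g : nat) (h : int).
Hypotheses (tr : translation_invariant P) (dec : decoupling P eps).
Hypotheses (d01 : 0 <= delta <= 2^-1).
Hypotheses (l1 : (1 <= l)%N) (g2 : (2 <= g)%N) (hg : `|h| <= g%:Z).

Let p01 := up_prob01 d01.

(** The displacement in the first block depends on the field in a rectangle
    around x, what follows depends on the field after the gap, and the two are
    decoupled; averaging over the first block is then one mean step. *)
Lemma mean_block_walk k s x u B :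
  (forall y, `|y - x| <= (k * (l + g))%N%:Z -> `|u y| <= B) ->
  `|\int[P]_f block_walk (up_prob delta f) l g h k s x u -
    iter k (mean_step P delta l h) u x| <=
  k%:R * (l.*2.+1%:R * (6 * B * eps l.*2 l g)).
Proof.
elim: k s x => [|k IH] s x uB.
  by rewrite /= mean_cst subrr normr0 mul0r.
set err := l.*2.+1%:R * _.
pose V y f := block_walk (up_prob delta f) l g h k (l + g + s) (y + h) u.
pose pi y f := ev (up_prob delta f) l s x (fun z => (z == y)%:R).
pose y_ (i : 'I_l.*2.+1) : int := x - l%:Z + i%:Z.
have y_x i : `|y_ i - x| <= l%:Z by rewrite /y_; have := ltn_ord i; lia.
have VB y f : `|y - x| <= l%:Z -> `|V y f| <= B.
  by move=> yx; apply: block_walk_norm => // z zy; apply: uB; nia.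
have piA y : simple_on [set z : Z2 | (`|z.1 - x| <= l%:Z) &&
    (s%:Z <= z.2 < s%:Z + l%:Z)] (pi y).
  apply: simple_on_ev => [z z1 z2|z _]; first by rewrite /= z1.
  exact: simple_on_cst.
have VA y : simple_on [set z : Z2 | (l + g + s)%N%:Z <= z.2] (V y).
  exact: simple_on_block_walk.
have mpi y := simple_on_bounded_measurable (piA y).
have mV y := simple_on_bounded_measurable (VA y).
pose v y := \int[P]_f V y f.
have step1 : \int[P]_f block_walk (up_prob delta f) l g h k.+1 s x u =
    \sum_i \int[P]_f (pi (y_ i) f * V (y_ i) f).
  have [_ <-] := mean_sum P (index_enum _)
    (fun i => bounded_measurableM (mpi (y_ i)) (mV (y_ i))).
  by apply: eq_Rintegral => f _; rewrite /= ev_kernel.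
have step2 : \int[P]_f ev (up_prob delta f) l s x v =
    \sum_i (\int[P]_f pi (y_ i) f * v (y_ i)).
  have [_] := mean_sum P (index_enum _)
    (fun i => bounded_measurableM (mpi (y_ i)) (bounded_measurable_cst _ (v (y_ i)))).
  rewrite (_ : \int[P]_f _ = \int[P]_f ev (up_prob delta f) l s x v); last first.
    by apply: eq_Rintegral => f _; rewrite [RHS]ev_kernel.
  move=> ->; apply: eq_bigr => i _; rewrite [RHS]mulrC -meanZ //.
  by apply: eq_Rintegral => f _; rewrite mulrC.
pose c y := iter k (mean_step P delta l h) u (y + h).
have step3 : iter k.+1 (mean_step P delta l h) u x =
    \int[P]_f ev (up_prob delta f) l s x c.
  by rewrite (mean_ev_shift _ _ _ _ _ tr).
have mev w : bounded_measurable (fun f => ev (up_prob delta f) l s x w).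
  have : simple_on setT (fun f => ev (up_prob delta f) l s x w).
    by apply: simple_on_ev => // y _; exact: simple_on_cst.
  exact: simple_on_bounded_measurable.
have vc : `|\int[P]_f ev (up_prob delta f) l s x v -
    \int[P]_f ev (up_prob delta f) l s x c| <= k%:R * err.
  rewrite -meanB //.
  apply: mean_norm_le => [|f]; first exact: bounded_measurableB.
  have -> : ev (up_prob delta f) l s x v - ev (up_prob delta f) l s x c =
      ev (up_prob delta f) l s x (fun y => v y + (-1) * c y).
    by rewrite evD evZ mulN1r.
  apply: ev_norm => // y yx; rewrite mulN1r; apply: IH => z zy.
  by apply: uB; nia.
rewrite step3 step1.
apply: le_trans (ler_distD (\int[P]_f ev (up_prob delta f) l s x v) _ _) _.
rewrite -[k.+1]addn1 natrD mulrDl mul1r addrC; apply: lerD => //.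
rewrite step2 -sumrB; apply: le_trans (ler_norm_sum _ _ _) _.
rewrite /err -[X in X%:R](card_ord l.*2.+1) mulr_natl -sumr_const.
apply: ler_sum => i _.
apply: (decoupling_covariance (a := x - l%:Z) (b := s%:Z) dec _ _ _ _ _
  (piA _) (VA _)) => //.
- by lia.
- move=> [z1 z2] /= /andP[zx zs]; rewrite /rectangle /=; lia.
- by move=> z z' /= /andP[z1 z2] z'2; rewrite /l1_dist; lia.
- move=> f; apply: ev_norm => // z _.
  by rewrite ger0_norm ?ler0n // lern1; case: (_ == _).
- by move=> f; exact: VB.
Qed.

End Blocks.

(** * Characteristic functions across scales *)

Definition walk_mean (R : realType) (P : probability (field_space R) R)
    (delta : R) (n : nat) (u : int -> R) : R :=
  \int[P]_f ev (up_prob delta f) n 0 0 u.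

(** Squared modulus of the characteristic function of X_n under the annealed
    law, at the frequency t. *)
Definition char_sq (R : realType) (P : probability (field_space R) R)
    (delta : R) (n : nat) (t : R) : R :=
  walk_mean P delta n (fun y => cos (t * y%:~R)) ^+ 2 +
  walk_mean P delta n (fun y => sin (t * y%:~R)) ^+ 2.

Section Char.
Variables (R : realType) (P : probability (field_space R) R) (delta : R).
Hypothesis d01 : 0 <= delta <= 2^-1.
Implicit Types (u : int -> R) (t : R).

Let p01 := up_prob01 d01.

Lemma ev_bounded_measurable n s x u :
  bounded_measurable (fun f => ev (up_prob delta f) n s x u).
Proof.
have : simple_on setT (fun f => ev (up_prob delta f) n s x u).
  by apply: simple_on_ev => // y _; exact: simple_on_cst.
exact: simple_on_bounded_measurable.
Qed.

Lemma walk_meanD n u v :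
  walk_mean P delta n (fun y => u y + v y) =
  walk_mean P delta n u + walk_mean P delta n v.
Proof.
rewrite /walk_mean -meanD; try exact: ev_bounded_measurable.
by apply: eq_Rintegral => f _; rewrite evD.
Qed.

Lemma walk_meanZ n a u :
  walk_mean P delta n (fun y => a * u y) = a * walk_mean P delta n u.
Proof.
rewrite /walk_mean -meanZ; last exact: ev_bounded_measurable.
by apply: eq_Rintegral => f _; rewrite evZ.
Qed.

Lemma walk_mean_cst n c : walk_mean P delta n (fun=> c) = c.
Proof.
rewrite /walk_mean -[RHS](mean_cst P).
by apply: eq_Rintegral => f _; rewrite ev_cst.
Qed.

Lemma walk_mean_kernel n : exists w : 'I_n.*2.+1 -> R,
  [/\ forall i, 0 <= w i, \sum_i w i = 1 &
      forall u, walk_mean P delta n u = \sum_i w i * u (0 - n%:Z + i%:Z)].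
Proof.
pose w (i : 'I_n.*2.+1) :=
  walk_mean P delta n (fun y => (y == 0 - n%:Z + i%:Z)%:R).
have wE u : walk_mean P delta n u = \sum_i w i * u (0 - n%:Z + i%:Z).
  have [_] := mean_sum P (index_enum _) (fun i : 'I_n.*2.+1 =>
    bounded_measurableM (ev_bounded_measurable n 0 0
      (fun y => (y == 0 - n%:Z + i%:Z)%:R))
    (bounded_measurable_cst _ (u (0 - n%:Z + i%:Z)))).
  rewrite /walk_mean => e.
  transitivity (\sum_(i < n.*2.+1)
      \int[P]_f (ev (up_prob delta f) n 0 0 (fun y => (y == 0 - n%:Z + i%:Z)%:R)
        * u (0 - n%:Z + i%:Z))).
    by rewrite -e; apply: eq_Rintegral => f _; rewrite ev_kernel.
  apply: eq_bigr => i _; rewrite [RHS]mulrC -meanZ; last exact: ev_bounded_measurable.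
  by apply: eq_Rintegral => f _; rewrite mulrC.
exists w; split => // [i|].
  apply: Rintegral_ge0 => f _.
  rewrite -(ev_cst (up_prob delta f) n 0 0 0).
  by apply: ev_le => // y _; exact: ler0n.
by rewrite -(walk_mean_cst n 1) wE; under [RHS]eq_bigr do rewrite mulr1.
Qed.

Lemma char_sq_half n t :
  (1 - char_sq P delta n t) / 4 <= 1 - char_sq P delta n (t / 2).
Proof.
have [w [w0 w1 wE]] := walk_mean_kernel n.
rewrite /char_sq !wE.
have e (u : R -> R) : \sum_i w i * u (t / 2 * (0 - n%:Z + i%:Z)%:~R) =
    \sum_i w i * u (t * (0 - n%:Z + i%:Z)%:~R / 2).
  by apply: eq_bigr => i _; rewrite mulrAC.
rewrite (e (@cos R)) (e (@sin R)); exact: char_fun_half.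
Qed.

Lemma mean_stepE l h u x :
  mean_step P delta l h u x = walk_mean P delta l (fun y => u (y + x + h)).
Proof. by []. Qed.

(** A mean step acts on the characters as the multiplication by a complex
    number of modulus the one of the characteristic function. *)
Lemma iter_mean_step_char k l h t : exists a b : R,
  [/\ a ^+ 2 + b ^+ 2 = char_sq P delta l t ^+ k,
    forall x, iter k (mean_step P delta l h) (fun y => cos (t * y%:~R)) x =
      a * cos (t * x%:~R) - b * sin (t * x%:~R) &
    forall x, iter k (mean_step P delta l h) (fun y => sin (t * y%:~R)) x =
      a * sin (t * x%:~R) + b * cos (t * x%:~R)].
Proof.
elim: k => [|k [a [b [ab IHc IHs]]]].
  by exists 1, 0; split => [|x|x] /=; rewrite ?expr0; ring.
pose c := walk_mean P delta l (fun y => cos (t * y%:~R)).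
pose s := walk_mean P delta l (fun y => sin (t * y%:~R)).
pose c' := c * cos (t * h%:~R) - s * sin (t * h%:~R).
pose s' := s * cos (t * h%:~R) + c * sin (t * h%:~R).
have stepc x : walk_mean P delta l (fun y => cos (t * (y + x + h)%:~R)) =
    c' * cos (t * x%:~R) - s' * sin (t * x%:~R).
  pose th := t * (x + h)%:~R.
  rewrite (_ : (fun y => _) = (fun y => cos th * cos (t * y%:~R) +
      (- sin th) * sin (t * y%:~R))).
    rewrite walk_meanD !walk_meanZ -/c -/s /th intrD mulrDr cosD sinD /c' /s'.
    by ring.
  apply/funext => y.
  by rewrite -addrA intrD mulrDr -/th cosD; ring.
have steps x : walk_mean P delta l (fun y => sin (t * (y + x + h)%:~R)) =
    c' * sin (t * x%:~R) + s' * cos (t * x%:~R).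
  pose th := t * (x + h)%:~R.
  rewrite (_ : (fun y => _) = (fun y => sin th * cos (t * y%:~R) +
      cos th * sin (t * y%:~R))).
    rewrite walk_meanD !walk_meanZ -/c -/s /th intrD mulrDr cosD sinD /c' /s'.
    by ring.
  apply/funext => y.
  by rewrite -addrA intrD mulrDr -/th sinD; ring.
exists (a * c' - b * s'), (a * s' + b * c'); split => [|x|x].
- rewrite [RHS]exprS -ab /char_sq -/c -/s.
  have := cos2Dsin2 (t * h%:~R) => cs.
  transitivity ((cos (t * h%:~R) ^+ 2 + sin (t * h%:~R) ^+ 2) *
    (c ^+ 2 + s ^+ 2) * (a ^+ 2 + b ^+ 2)); first by rewrite /c' /s'; ring.
  by rewrite cs mul1r.
- rewrite iterS mean_stepE.
  under [X in walk_mean _ _ _ X]eq_fun do rewrite IHc.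
  rewrite (_ : (fun y => _) = (fun y => a * cos (t * (y + x + h)%:~R) +
      (- b) * sin (t * (y + x + h)%:~R))); last first.
    by apply/funext => y; rewrite mulNr.
  by rewrite walk_meanD !walk_meanZ stepc steps; ring.
- rewrite iterS mean_stepE.
  under [X in walk_mean _ _ _ X]eq_fun do rewrite IHs.
  by rewrite walk_meanD !walk_meanZ stepc steps; ring.
Qed.

Lemma iter_mean_step_intr k l h x :
  iter k (mean_step P delta l h) intr x =
  x%:~R + k%:R * (walk_mean P delta l intr + h%:~R).
Proof.
elim: k x => [|k IH] x; first by rewrite /= mul0r addr0.
rewrite iterS mean_stepE.
under [X in walk_mean _ _ _ X]eq_fun do rewrite IH.
set m := walk_mean _ _ _ _ in IH *.
rewrite (_ : (fun y => _) = (fun y => y%:~R +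
    (x%:~R + h%:~R + k%:R * (m + h%:~R)))); last first.
  by apply/funext => y; rewrite !intrD; ring.
by rewrite walk_meanD walk_mean_cst -/m -natr1; ring.
Qed.

Section Comparison.
Variables (eps : nat -> nat -> nat -> R) (l g : nat).
Hypotheses (tr : translation_invariant P) (dec : decoupling P eps).
Hypotheses (l1 : (1 <= l)%N) (g2 : (2 <= g)%N).

Lemma block_walk_bounded_measurable h k x u : bounded_measurable
  (fun f => block_walk (up_prob delta f) l g h k 0 x u).
Proof. exact: simple_on_bounded_measurable (simple_on_block_walk _ _ _ _ _ _ _ _). Qed.

(** The three terms of the error come from the last j steps, from the distance
    between the two extreme block walks, and from decoupling.  In the second
    one, the mean displacements in the blocks cancel and only the gaps remain,
    whatever the drift of the walk. *)
Lemma walk_mean_comparison k j u t : 0 <= t ->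
  (forall y z, `|u y - u z| <= t * `|y - z|%:~R) -> (forall y, `|u y| <= 1) ->
  `|walk_mean P delta (k * (l + g) + j) u -
    iter k (mean_step P delta l g%:Z) u 0| <=
  t * j%:R + t * (2 * k%:R * g%:R +
    2 * k%:R * (l.*2.+1%:R * (6 * (k * (l + g))%N%:R * eps l.*2 l g))) +
  k%:R * (l.*2.+1%:R * (6 * 1 * eps l.*2 l g)).
Proof.
move=> t0 uL u1.
have hg : `|g%:Z| <= g%:Z by [].
have hNg : `|- g%:Z| <= g%:Z by rewrite normrN.
have uB : forall y : int, `|y - 0| <= (k * (l + g))%N%:Z -> `|u y| <= 1 by [].
have iB : forall y : int, `|y - 0| <= (k * (l + g))%N%:Z ->
    `|y%:~R : R| <= (k * (l + g))%N%:R.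
  by move=> y; rewrite subr0 => yn; rewrite -intr_norm [leRHS]pmulrn ler_int.
have cu := mean_block_walk tr dec d01 l1 g2 hg 0 uB.
have cp := mean_block_walk tr dec d01 l1 g2 hg 0 iB.
have cm := mean_block_walk tr dec d01 l1 g2 hNg 0 iB.
rewrite !iter_mean_step_intr in cp cm.
set e1 := k%:R * (_ * (6 * 1 * _)) in cu *.
set e2 := k%:R * (_ * (6 * _ * _)) in cp cm *.
rewrite -[2 * k%:R * (_ * _)]mulrA -/e2.
have rest : `|walk_mean P delta (k * (l + g) + j) u -
    walk_mean P delta (k * (l + g)) u| <= t * j%:R.
  rewrite /walk_mean -meanB; try exact: ev_bounded_measurable.
  apply: mean_norm_le => [|f].
    by apply: bounded_measurableB; exact: ev_bounded_measurable.
  rewrite ev_add evB; apply: ev_norm => // y _.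
  rewrite -(ev_cst (up_prob delta f) j (k * (l + g) + 0) y (u y)) evB.
  apply: ev_norm => // z zy.
  apply: (le_trans (uL _ _)); apply: ler_wpM2l => //.
  by rewrite pmulrn ler_int.
have blocks : `|walk_mean P delta (k * (l + g)) u -
    \int[P]_f block_walk (up_prob delta f) l g g%:Z k 0 0 u| <=
    t * (2 * k%:R * g%:R + 2 * e2).
  have mb := block_walk_bounded_measurable.
  rewrite /walk_mean -meanB //; last exact: ev_bounded_measurable.
  apply: (@le_trans _ _ (\int[P]_f (t * (
      block_walk (up_prob delta f) l g g%:Z k 0 0 intr -
      block_walk (up_prob delta f) l g (- g%:Z) k 0 0 intr)))).
    apply: mean_norm => [||f].
    - by apply: bounded_measurableB => //; exact: ev_bounded_measurable.
    - by apply: bounded_measurableZ; exact: bounded_measurableB.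
    apply: ev_block_walk_dist => // y.
    by apply: (le_trans (uL _ _)); rewrite addrAC subrr add0r mulrC.
  rewrite meanZ; last exact: bounded_measurableB.
  rewrite meanB //; apply: ler_wpM2l => //.
  move: cp cm; rewrite !ler_norml intrN => /andP[_ cp] /andP[cm _].
  rewrite -pmulrn in cp cm; lra.
have -> : walk_mean P delta (k * (l + g) + j) u -
    iter k (mean_step P delta l g%:Z) u 0 =
  (walk_mean P delta (k * (l + g) + j) u - walk_mean P delta (k * (l + g)) u) +
  (walk_mean P delta (k * (l + g)) u -
    \int[P]_f block_walk (up_prob delta f) l g g%:Z k 0 0 u) +
  (\int[P]_f block_walk (up_prob delta f) l g g%:Z k 0 0 u -
    iter k (mean_step P delta l g%:Z) u 0) by ring.
apply: (le_trans (ler_normD _ _)); apply: lerD => //.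
by apply: (le_trans (ler_normD _ _)); exact: lerD.
Qed.

End Comparison.

End Char.

(** * Arithmetic of one change of scale *)

Lemma eighth_root n : exists g, (g ^ 8 <= n < g.+1 ^ 8)%N.
Proof.
elim: n => [|n [g /andP[gn ng]]]; first by exists 0%N.
have [h|h] := ltnP n.+1 (g.+1 ^ 8)%N; first by exists g; rewrite h (leqW gn).
by exists g.+1; rewrite h /= (leq_ltn_trans ng) // ltn_exp2r.
Qed.

(** The blocks are as long as possible when eight of them, with their gaps, fit
    in the time n, and g is the integer part of the eighth root of n. *)
Lemma scale_arith n g : (2 <= g)%N -> (g ^ 8 <= n < g.+1 ^ 8)%N ->
  let l := (n %/ 8 - g)%N in
  [/\ n = (8 * (l + g) + n %% 8)%N, (n <= 16 * l)%N, (g <= l)%N,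
      (l <= 32 * g ^ 8)%N & (l < n)%N].
Proof.
move=> g2 /andP[gn ng] l.
have g7 : (2 ^ 7 <= g ^ 7)%N by rewrite leq_exp2r.
have : (g * 128 <= n)%N.
  by apply: leq_trans gn; rewrite [(g ^ 8)%N]expnS leq_mul2l orbC g7.
have : (n < 256 * g ^ 8)%N.
  apply: (leq_trans ng); rewrite -[256%N]/(2 ^ 8)%N -expnMn leq_exp2r //; lia.
by move=> ? ?; have := divn_eq n 8; have := ltn_pmod n (isT : 0 < 8)%N;
  rewrite /l => *; split; lia.
Qed.

Section Scales.
Variable R : realType.

(** The error of the comparison when k = 8 and the decoupling rate decays as
    g^(-33).  The decoupling terms are of order L^4 g^(-33), and L^4 is at most
    of order g^32; the displacements in the gaps are of order t g, and t is at
    most g^(-2).  Both are of order 1 / g. *)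
Lemma scale_error (c1 L g eta t j : R) :
  0 < c1 -> 2 <= g -> g <= L -> L <= 32 * g ^+ 8 ->
  eta <= c1 * (2 * L * L + (2 * L + L) * g + g ^+ 2) * (g ^+ 33)^-1 ->
  0 <= t -> t <= 1 -> t * g ^+ 2 <= 1 -> 0 <= j -> j <= 7 ->
  t * j + t * (2 * 8 * g + 2 * 8 * ((2 * L + 1) * (6 * (8 * (L + g)) * eta))) +
    8 * ((2 * L + 1) * (6 * 1 * eta)) <= (23 + (16 * 1728 + 8 * 108) * 2 ^+ 20 * c1) / g.
Proof.
move=> c0 g2 gL Lg etaB t0 t1 tg j0 j7.
have g0 : 0 < g by lra.
have L0 : 0 < L by lra.
set s := (g ^+ 33)^-1 in etaB.
have s0 : 0 < s by rewrite invr_gt0 exprn_gt0.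
set gi := g^-1.
have gi0 : 0 < gi by rewrite invr_gt0.
have ggi : g * gi = 1 by rewrite divff // gt_eqF.
have etaB' : eta <= 6 * c1 * L ^+ 2 * s.
  apply: (le_trans etaB); rewrite ler_wpM2r ?(ltW s0) //.
  have : g * L <= L * L by rewrite ler_wpM2r // ltW.
  have : g * g <= L * L by apply: ler_pM => //; exact: ltW.
  move=> h1 h2.
  have : 2 * L * L + (2 * L + L) * g + g ^+ 2 <= 6 * L ^+ 2.
    by rewrite !expr2; nra.
  move=> h; have -> : 6 * c1 * L ^+ 2 = c1 * (6 * L ^+ 2) by ring.
  exact: (ler_wpM2l (ltW c0) h).
have LW : L ^+ 4 * s <= 2 ^+ 20 * gi.
  have : L ^+ 4 <= (32 * g ^+ 8) ^+ 4 by rewrite lerXn2r // nnegrE; lra.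
  move=> h; apply: (le_trans (ler_wpM2r (ltW s0) h)).
  have -> : (32 * g ^+ 8) ^+ 4 * s = 2 ^+ 20 * gi * (g ^+ 33 * s).
    have -> : g ^+ 33 = g * g ^+ 32 by rewrite -exprS.
    transitivity (2 ^+ 20 * (g * gi) * g ^+ 32 * s); last by ring.
    by rewrite ggi exprMn -exprM -natrX -natrX; ring.
  by rewrite /s divff ?mulr1 // expf_neq0 // gt_eqF.
have t1g : t * g <= gi.
  have : t * g ^+ 2 * gi <= 1 * gi by rewrite ler_wpM2r // ltW.
  by rewrite mul1r expr2 mulrA -mulrA ggi mulr1.
have tj : t * j <= 7 * gi.
  have : t <= t * g by nra.
  move=> h; have : t * j <= t * 7 by rewrite ler_wpM2l.
  lra.
have c1W : c1 * (L ^+ 4 * s) <= c1 * (2 ^+ 20 * gi) by rewrite ler_wpM2l // ltW.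
have c1W0 : 0 <= c1 * (L ^+ 4 * s) by rewrite !mulr_ge0 ?exprn_ge0 // ltW.
have LL : L ^+ 3 * s <= L ^+ 4 * s.
  rewrite ler_wpM2r ?(ltW s0) // [leRHS]exprS ler_peMl ?exprn_ge0 //; lra.
have L3 : 2 * L + 1 <= 3 * L by lra.
have tA : (2 * L + 1) * (6 * (8 * (L + g)) * eta) <=
    1728 * (c1 * (L ^+ 4 * s)).
  apply: (@le_trans _ _ ((2 * L + 1) * (6 * (8 * (L + g)) * (6 * c1 * L ^+ 2 * s)))).
    by rewrite ler_wpM2l ?ler_wpM2l //; lra.
  have e0 : 0 <= 6 * c1 * L ^+ 2 * s by rewrite !mulr_ge0 ?exprn_ge0 // ltW.
  apply: (@le_trans _ _ ((3 * L) * (6 * (8 * (L + L)) * (6 * c1 * L ^+ 2 * s)))).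
    apply: ler_pM => //; [lra| |].
      by rewrite mulr_ge0 //; lra.
    by rewrite ler_wpM2r //; lra.
  by rewrite le_eqVlt; apply/orP; left; apply/eqP; ring.
have tB : (2 * L + 1) * (6 * 1 * eta) <= 108 * (c1 * (L ^+ 4 * s)).
  apply: (@le_trans _ _ ((2 * L + 1) * (6 * 1 * (6 * c1 * L ^+ 2 * s)))).
    by rewrite ler_wpM2l ?ler_wpM2l //; lra.
  have e0 : 0 <= 6 * 1 * (6 * c1 * L ^+ 2 * s).
    by rewrite !mulr_ge0 ?exprn_ge0 // ltW.
  apply: (le_trans (ler_wpM2r e0 L3)).
  have := ler_wpM2l (ltW c0) LL => h.
  have -> : 3 * L * (6 * 1 * (6 * c1 * L ^+ 2 * s)) = 108 * (c1 * (L ^+ 3 * s)) by ring.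
  lra.
set W := c1 * (L ^+ 4 * s) in c1W c1W0 tA tB.
set EA := _ * _ in tA; set EB := _ * _ in tB.
rewrite -/gi -/EA -/EB.
have tEA : t * EA <= 1728 * W.
  have : t * EA <= t * (1728 * W) by rewrite ler_wpM2l.
  by nra.
set q := 2 ^+ 20 * gi in c1W.
have -> : (23 + (16 * 1728 + 8 * 108) * 2 ^+ 20 * c1) * gi =
    23 * gi + (16 * 1728 + 8 * 108) * (c1 * q).
  by rewrite /q; ring.
lra.
Qed.

(** Here (7/8)^8 < 0.35 leaves room for the two errors of 1/40. *)
Lemma char_sq_close (a b c s rho : R) :
  a ^+ 2 + b ^+ 2 = rho ^+ 8 -> 0 <= rho <= 7 / 8 ->
  `|c - a| <= 1 / 40 -> `|s - b| <= 1 / 40 -> c ^+ 2 + s ^+ 2 <= 1 / 2.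
Proof.
move=> ab /andP[r0 r1]; rewrite !ler_norml => /andP[c1 c2] /andP[s1 s2].
have r8 : rho ^+ 8 <= 35 / 100.
  apply: (@le_trans _ _ ((7 / 8) ^+ 8)); first by rewrite lerXn2r // nnegrE; lra.
  by rewrite !exprS expr0; lra.
have a1 : -1 <= a <= 1 by apply/andP; split; nra.
have b1 : -1 <= b <= 1 by apply/andP; split; nra.
move: a1 b1 => /andP[a1 a2] /andP[b1 b2].
have hc : c ^+ 2 <= a ^+ 2 + 2 / 40 + 1 / 1600.
  have -> : c ^+ 2 = a ^+ 2 + 2 * (a * (c - a)) + (c - a) ^+ 2 by ring.
  by nra.
have hs : s ^+ 2 <= b ^+ 2 + 2 / 40 + 1 / 1600.
  have -> : s ^+ 2 = b ^+ 2 + 2 * (b * (s - b)) + (s - b) ^+ 2 by ring.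
  by nra.
lra.
Qed.

End Scales.

(** * The law of the walk under the quenched and annealed measures *)

Section Quenched.
Variables (R : realType) (delta : R) (d : measure_display).
Variables (Omega : measurableType d) (X : nat -> Omega -> int).
Hypothesis d01 : 0 <= delta <= 2^-1.

Definition history (m : nat) (x : nat -> int) : set Omega :=
  [set om | forall i : nat, (i <= m)%N -> X i om = x i].

Section OneField.
Variables (f : field_space R) (Q : probability Omega R).
Hypothesis walk : quenched_walk delta f Q X.

Lemma measurable_position n (B : int -> bool) :
  measurable [set om | B (X n om)].
Proof.
have [mX _ _] := walk.
have -> : [set om | B (X n om)] =
    \bigcup_(y in [set: int]) ([set om | X n om = y] `&` [set om | B y]).
  apply/seteqP; split => [om /= Bx|om [y _ [/= <-]]] //.
  by exists (X n om).
apply: countable_bigcupT_measurable => [|y]; first exact: countableP.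
apply: measurableI; first exact: mX.
case: (B y).
  by rewrite (_ : [set om | true] = setT) //; apply/seteqP; split.
by rewrite (_ : [set om | false] = set0) //; apply/seteqP; split.
Qed.

Lemma measurable_history m x : measurable (history m x).
Proof.
have [mX _ _] := walk.
have -> : history m x = \bigcap_(i in [set i | (i <= m)%N]) [set om | X i om = x i].
  by apply/seteqP; split => [om h i /= im|om h i im]; apply: h.
by apply: bigcap_measurableType => i _; exact: mX.
Qed.

Lemma history_ext m x x' : (forall i, (i <= m)%N -> x i = x' i) ->
  history m x = history m x'.
Proof.
move=> xx'; apply/seteqP; split => om h i im; rewrite (h i im) xx' //.
Qed.

(** Summing over the histories of positive probability gives a lower bound by
    finite additivity alone.  It is an equality, but the reverse inequality is
    more easily obtained from the complementary event. *)
Lemma history_lower n m x (B : int -> bool) :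
  (Q (history m x) * (ev (up_prob delta f) n m (x m) (fun y => (B y)%:R))%:E <=
   Q (history m x `&` [set om | B (X (n + m)%N om)]))%E.
Proof.
have [_ _ wQ] := walk.
elim: n m x => [|n IH] m x.
  rewrite /=; case Bx: (B (x m)); last by rewrite mule0 measure_ge0.
  rewrite mule1 (_ : _ `&` _ = history m x) //.
  apply/seteqP; split => [om []//|om h]; split => //=.
  by rewrite add0n h.
rewrite [ev _ _ _ _ _]/=.
pose ext (e : int) i := if (i <= m)%N then x i else x m + e.
have exth e : history m (ext e) = history m x.
  by apply: history_ext => i im; rewrite /ext im.
have extm e : ext e m.+1 = x m + e by rewrite /ext ltnn.
have sub e : history m.+1 (ext e) `<=` history m x.
  by move=> om h; rewrite -(exth e) => i im; apply: h; exact: leqW.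
have Qe e : Q (history m.+1 (ext e)) =
    (Q (history m x) * (transition delta f m (x m) (x m + e))%:E)%E.
  by have := wQ m (ext e); rewrite -/(history _ _) -/(history _ _) exth extm /ext leqnn.
have mh e : measurable (history m.+1 (ext e) `&` [set om | B (X (n + m.+1)%N om)]).
  by apply: measurableI; [exact: measurable_history|exact: measurable_position].
have dis : (history m.+1 (ext 1) `&` [set om | B (X (n + m.+1)%N om)]) `&`
    (history m.+1 (ext (-1)) `&` [set om | B (X (n + m.+1)%N om)]) = set0.
  apply/seteqP; split => // om [[h1 _] [h2 _]].
  have := h1 m.+1 (leqnn _); rewrite (h2 m.+1 (leqnn _)) !extm; lia.
apply: (@le_trans _ _ (Q ((history m.+1 (ext 1) `&` [set om | B (X (n + m.+1)%N om)]) `|`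
    (history m.+1 (ext (-1)) `&` [set om | B (X (n + m.+1)%N om)])))).
  rewrite measureU //.
  have h1 := IH m.+1 (ext 1); have h2 := IH m.+1 (ext (-1)).
  apply: le_trans (leeD h1 h2); rewrite !Qe !extm /transition !eqxx.
  have -> : (x m - 1 == x m + 1) = false by lia.
  rewrite -!muleA -!EFinM -muleDr // fin_num_measure //.
  exact: measurable_history.
rewrite addSnnS; apply: le_measure; rewrite ?inE.
- exact: measurableU.
- by apply: measurableI; [exact: measurable_history|exact: measurable_position].
- by move=> om [[h hB]|[h hB]]; split => //; exact: (sub _ _ h).
Qed.

(** The lower bounds for an event and for its complement add up to 1. *)
Lemma quenched_lawE n (B : int -> bool) :
  Q [set om | B (X n om)] =
  (ev (up_prob delta f) n 0 0 (fun y => (B y)%:R))%:E.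
Proof.
have [mX Q0 _] := walk.
have h0 : Q (history 0 (fun=> 0)) = 1%E.
  rewrite -Q0; congr (Q _); apply/seteqP; split => [om h|om /= h [|//]] //.
  exact: h.
have low (C : int -> bool) : ((ev (up_prob delta f) n 0 0 (fun y => (C y)%:R))%:E <=
    Q [set om | C (X n om)])%E.
  have := history_lower n 0 (fun=> 0) C; rewrite h0 mul1e addn0 => h.
  apply: (le_trans h); apply: le_measure; rewrite ?inE.
  - by apply: measurableI; [exact: measurable_history|exact: measurable_position].
  - exact: measurable_position.
  - by move=> om [].
apply/eqP; rewrite eq_le low andbT.
have := low (fun y => ~~ B y).
have -> : [set om | ~~ B (X n om)] = ~` [set om | B (X n om)].
  by apply/seteqP; split => om /= /negP.
rewrite probability_setC; last exact: measurable_position.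
have -> : ev (up_prob delta f) n 0 0 (fun y => (~~ B y)%:R) =
    1 - ev (up_prob delta f) n 0 0 (fun y => (B y)%:R).
  rewrite -[X in X - _](ev_cst (up_prob delta f) n 0 0) evB; congr ev.
  by apply/funext => y; case: (B y); rewrite ?subrr ?subr0.
have mB := measurable_position n B.
rewrite -(fineK (fin_num_measure Q _ mB)) -EFinB !lee_fin; lra.
Qed.

End OneField.

Lemma annealedE (P : probability (field_space R) R)
    (Pf : field_space R -> probability Omega R) n (B : int -> bool) :
  (forall f, quenched_walk delta f (Pf f) X) ->
  annealed P Pf [set om | B (X n om)] =
  (walk_mean P delta n (fun y => (B y)%:R))%:E.
Proof.
move=> walk; rewrite /annealed.
under eq_integral do rewrite (quenched_lawE (walk _)).
rewrite /walk_mean /Rintegral fineK //.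
apply: integrable_fin_num => //.
exact/bounded_measurable_integrable/ev_bounded_measurable.
Qed.

End Quenched.

(** * Propagation of the spreading estimate *)

(** X_n is spread at the scale M, of order at least n^(1/4).  The factor 16 is
    the loss in time when M is doubled, and it also makes n^(1/4) smaller than
    M / 2. *)
Definition spread (R : realType) (P : probability (field_space R) R)
    (delta : R) (n : nat) : Prop :=
  exists M : nat, [/\ (0 < M)%N, (16 * n <= M ^ 4)%N &
    char_sq P delta n (M%:R^-1) <= 1 / 2].

(** Gaps at least this long make the error of one change of scale at most
    1/40. *)
Definition scale_constant (R : realType) (c1 : R) : R :=
  40 * (23 + (16 * 1728 + 8 * 108) * 2 ^+ 20 * c1).

Section Spread.
Variables (R : realType) (P : probability (field_space R) R) (delta : R).
Hypothesis d01 : 0 <= delta <= 2^-1.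

Let p01 := up_prob01 d01.

Lemma cos_int_lipschitz (t : R) : 0 <= t -> forall y z : int,
  `|cos (t * y%:~R) - cos (t * z%:~R)| <= t * `|y - z|%:~R.
Proof.
move=> t0 y z; apply: (le_trans (cos_lipschitz _ _)).
by rewrite -mulrBr normrM (ger0_norm t0) intr_norm intrB.
Qed.

Lemma sin_int_lipschitz (t : R) : 0 <= t -> forall y z : int,
  `|sin (t * y%:~R) - sin (t * z%:~R)| <= t * `|y - z|%:~R.
Proof.
move=> t0 y z; apply: (le_trans (sin_lipschitz _ _)).
by rewrite -mulrBr normrM (ger0_norm t0) intr_norm intrB.
Qed.

(** One change of scale: the frequency 1 / M is halved, which brings the squared
    modulus for a block from 1/2 up to 7/8 at most, and the eight nearly
    independent blocks bring it back under 1/2. *)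
Lemma spread_step (eps : nat -> nat -> nat -> R) (c1 : R) (n g : nat) :
  translation_invariant P -> decoupling P eps -> 0 < c1 ->
  (forall w h r : nat, (1 <= w)%N -> (1 <= h)%N -> (2 <= r)%N ->
    eps w h r <= c1 * (w%:R * h%:R + (w%:R + h%:R) * r%:R + r%:R ^+ 2) *
      r%:R `^ (- 33%:R)) ->
  (2 <= g)%N -> scale_constant c1 <= g%:R -> (g ^ 8 <= n < g.+1 ^ 8)%N ->
  spread P delta (n %/ 8 - g) -> spread P delta n.
Proof.
move=> tr dec c10 epsB g2 gK gn.
have [] := scale_arith g2 gn.
set l := (n %/ 8 - g)%N => nE nl gl lg _ [M [M0 lM cM]].
have l1 : (1 <= l)%N by apply: leq_trans gl; exact: ltnW.
exists (2 * M)%N; split; first by rewrite muln_gt0.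
  by rewrite expnMn; apply: leq_trans (leq_mul (leqnn 16) nl) _; rewrite leq_mul2l lM orbT.
set t : R := (2 * M)%N%:R^-1.
have tM : t = M%:R^-1 / 2 by rewrite /t natrM invfM mulrC.
have MR : 1 <= M%:R :> R by rewrite ler1n.
have gR : 2 <= g%:R :> R by rewrite ler_nat.
have gM : (g ^ 2 <= M)%N.
  rewrite -(leq_exp2r _ _ (isT : 0 < 4)%N) -expnM.
  by apply: leq_trans lM; apply: leq_trans nl; case/andP: gn.
have t0 : 0 <= t by rewrite invr_ge0.
have tM1 : t * M%:R <= 1.
  by rewrite tM mulrAC mulVf ?mul1r; [lra|rewrite pnatr_eq0 -lt0n].
have t1 : t <= 1 by nra.
have tg : t * g%:R ^+ 2 <= 1.
  by apply: le_trans tM1; rewrite ler_wpM2l // -natrX ler_nat.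
have j7 : (n %% 8)%:R <= 7 :> R by rewrite ler_nat -ltnS ltn_pmod.
have etaB : eps l.*2 l g <= c1 * (2 * l%:R * l%:R + (2 * l%:R + l%:R) * g%:R +
    g%:R ^+ 2) * (g%:R ^+ 33)^-1.
  have := epsB l.*2 l g; rewrite powR_invn // -mul2n natrM; apply => //.
  by rewrite mul2n double_gt0.
have gl' : g%:R <= l%:R :> R by rewrite ler_nat.
have lg' : l%:R <= 32 * g%:R ^+ 8 :> R by rewrite -natrX -natrM ler_nat.
have err := scale_error c10 gR gl' lg' etaB t0 t1 tg (ler0n _ (n %% 8)) j7.
have e40 : (23 + (16 * 1728 + 8 * 108) * 2 ^+ 20 * c1) / g%:R <= 1 / 40.
  by rewrite ler_pdivrMr; [move: gK; rewrite /scale_constant; lra|lra].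
have {e40}err := le_trans err e40.
have comp u : (forall y z, `|u y - u z| <= t * `|y - z|%:~R) ->
    (forall y, `|u y| <= 1) ->
    `|walk_mean P delta n u - iter 8 (mean_step P delta l g%:Z) u 0| <= 1 / 40.
  move=> uL u1.
  have := walk_mean_comparison d01 tr dec l1 g2 8 (n %% 8) t0 uL u1.
  rewrite -nE => h; apply: (le_trans h); apply: le_trans err.
  have -> : l.*2.+1%:R = 2 * l%:R + 1 :> R by rewrite -natr1 -mul2n (natrM R 2).
  rewrite (natrM R 8) (natrD R l g).
  by rewrite le_eqVlt; apply/orP; left; apply/eqP; ring.
have [a [b [ab itc its]]] := iter_mean_step_char P delta 8 l g%:Z t.
have cc := comp _ (cos_int_lipschitz t0) (fun y => cos_max _).
have ss := comp _ (sin_int_lipschitz t0) (fun y => sin_max _).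
rewrite itc mulr0 cos0 sin0 mulr1 mulr0 subr0 in cc.
rewrite its mulr0 cos0 sin0 mulr1 mulr0 add0r in ss.
apply: (char_sq_close ab _ cc ss).
apply/andP; split; first by rewrite /char_sq addr_ge0 ?sqr_ge0.
have := char_sq_half P d01 l M%:R^-1; rewrite -tM; lra.
Qed.

Lemma walk_mean_close n (u : int -> R) c B :
  (forall f, `|ev (up_prob delta f) n 0 0 u - c| <= B) ->
  `|walk_mean P delta n u - c| <= B.
Proof.
move=> uB; rewrite -[X in _ - X](walk_mean_cst P delta n) /walk_mean -meanB;
  try exact: ev_bounded_measurable.
apply: mean_norm_le => [|f]; first by apply: bounded_measurableB; exact: ev_bounded_measurable.
by rewrite ev_cst.
Qed.

(** A drift of order delta perturbs the characteristic function of the simple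
    random walk by at most 2 delta at each step. *)
Lemma ev_cos_close f n s x (t c : R) :
  `|ev (up_prob delta f) n s x (fun y => cos (t * y%:~R + c)) -
    cos t ^+ n * cos (t * x%:~R + c)| <= 2 * delta * n%:R.
Proof.
elim: n s x => [|n IH] s x; first by rewrite /= expr0 mul1r subrr normr0 mulr0.
have /andP[p0 p1] := p01 f x s.
have := IH s.+1 (x + 1); have := IH s.+1 (x - 1).
rewrite /= !intrD intrN !mulrDr mulrN mulr1 => h2 h1.
set E1 := ev _ _ _ (x + 1) _ in h1 *; set E2 := ev _ _ _ (x - 1) _ in h2 *.
have pd : `|1 - 2 * up_prob delta f x s| <= 2 * delta.
  move: d01; rewrite /up_prob ler_norml => /andP[d0 d1].
  by case: (ltgtP (f (x, s%:Z)) 0) => _ /=; rewrite ?mulr1n ?mulr0n;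
    apply/andP; split; lra.
set p := up_prob delta f x s in p0 p1 pd *.
set th := t * x%:~R in h1 h2 *.
have -> : p * E1 + (1 - p) * E2 - cos t ^+ n.+1 * cos (th + c) =
  p * (E1 - cos t ^+ n * cos (th + t + c)) +
  (1 - p) * (E2 - cos t ^+ n * cos (th - t + c)) +
  (1 - 2 * p) * (cos t ^+ n * (sin t * sin (th + c))).
  have -> : th + t + c = th + c + t by ring.
  have -> : th - t + c = th + c - t by ring.
  by rewrite (cosD (th + c)) (cosB (th + c)) exprS; ring.
apply: (le_trans (ler_normD _ _)).
have -> : 2 * delta * n.+1%:R = 2 * delta * n%:R + 2 * delta by rewrite -natr1; ring.
apply: lerD.
  apply: (le_trans (ler_normD _ _)).
  rewrite !normrM (ger0_norm p0) (ger0_norm (_ : 0 <= 1 - p)); last by lra.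
  move: h1 h2; set a1 := `|_|; set a2 := `|_|; set B := 2 * delta * _.
  by move=> h1 h2; nra.
rewrite normrM -[leRHS]mulr1; apply: ler_pM => //.
rewrite !normrM normrX mulr_ile1 ?mulr_ge0 ?exprn_ile1 ?cos_max //.
by rewrite mulr_ile1 ?sin_max.
Qed.

Lemma bernoulli_inverse (x : R) n : 0 <= x <= 1 -> (1 - x) ^+ n * (1 + n%:R * x) <= 1.
Proof.
move=> /andP[x0 x1]; elim: n => [|n IH]; first by rewrite expr0 mul0r addr0 mulr1.
apply: le_trans IH; rewrite exprSr -mulrA ler_wpM2l ?exprn_ge0 ?subr_ge0 //.
have n0 : 0 <= n%:R :> R by [].
rewrite -natr1; set m : R := n%:R in n0 *.
have : 0 <= m * x ^+ 2 by rewrite mulr_ge0 ?sqr_ge0.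
have := sqr_ge0 x; nra.
Qed.

(** After a time of order M^2 the characteristic function cos(1 / M)^n of the
    simple random walk is at most 1/2, and the drift changes it by at most
    2 delta n. *)
Lemma char_sq_base (M n : nat) : (0 < M)%N -> (4 * M ^ 2 <= n)%N ->
  delta * n%:R <= 1 / 32 -> char_sq P delta n (M%:R^-1) <= 1 / 2.
Proof.
move=> M0 Mn dn.
set t : R := M%:R^-1.
have MR : 1 <= M%:R :> R by rewrite ler1n.
have tM : t * M%:R = 1 by rewrite mulVf // pnatr_eq0 -lt0n.
have t0 : 0 <= t by rewrite invr_ge0.
have t1 : t <= 1 by nra.
have cle := @cos_le_quadratic R t (introT andP (conj t0 t1)).
have cge := cos_ge_quadratic t.
have t2 : 0 <= t ^+ 2 <= 1 by rewrite sqr_ge0 /= exprn_ile1.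
have c0 : 0 <= cos t by move: t2 => /andP[? ?]; lra.
have cn0 : 0 <= cos t ^+ n by rewrite exprn_ge0.
have cn : cos t ^+ n <= 1 / 2.
  apply: (@le_trans _ _ ((1 - t ^+ 2 / 4) ^+ n)).
    by rewrite lerXn2r // nnegrE; lra.
  have x01 : 0 <= t ^+ 2 / 4 <= 1 by move: t2 => /andP[? ?]; apply/andP; split; lra.
  have := bernoulli_inverse n x01.
  have nx : 1 <= n%:R * (t ^+ 2 / 4).
    have : (4 * M ^ 2)%N%:R * (t ^+ 2 / 4) <= n%:R * (t ^+ 2 / 4).
      by rewrite ler_wpM2r ?ler_nat //; case/andP: x01.
    apply: le_trans; rewrite natrM natrX.
    have -> : 4 * M%:R ^+ 2 * (t ^+ 2 / 4) = (t * M%:R) ^+ 2 by field.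
    by rewrite tM expr1n.
  have : 0 <= (1 - t ^+ 2 / 4) ^+ n by rewrite exprn_ge0 //; case/andP: x01; lra.
  set z := _ ^+ n; set y := n%:R * _ in nx *; nra.
have hc : `|walk_mean P delta n (fun y => cos (t * y%:~R)) - cos t ^+ n| <= 1 / 16.
  apply: walk_mean_close => f; have := ev_cos_close f n 0 0 t 0.
  rewrite mulr0 addr0 cos0 mulr1.
  under [X in ev _ _ _ _ X]eq_fun do rewrite addr0.
  by move=> h; apply: (le_trans h); lra.
have hs : `|walk_mean P delta n (fun y => sin (t * y%:~R)) - 0| <= 1 / 16.
  apply: walk_mean_close => f; have := ev_cos_close f n 0 0 t (- (pi / 2)).
  rewrite mulr0 cosBpihalf sin0 mulr0.
  under [X in ev _ _ _ _ X]eq_fun do rewrite cosBpihalf.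
  by move=> h; apply: (le_trans h); lra.
rewrite /char_sq; move: hc hs; rewrite subr0 !ler_norml.
set a := walk_mean _ _ _ _; set b := walk_mean _ _ _ _.
move=> /andP[a1 a2] /andP[b1 b2]; nra.
Qed.

(** If |X_n| < M / 2 then cos (X_n / M) >= 7/8, so a small probability of
    |X_n| >= M / 2 would bring the real part of the characteristic function
    close to 7/8, whose square exceeds 1/2. *)
Lemma spread_walk_mean n : spread P delta n ->
  1 / 16 <= walk_mean P delta n
    (fun y => (n%:R `^ 4^-1 <= `|y|%:~R :> R)%R%:R).
Proof.
move=> [M [M0 nM cM]]; set xi : R := 4^-1.
set t : R := M%:R^-1 in cM.
have MR : 0 < M%:R :> R by rewrite ltr0n.
have tM : t * M%:R = 1 by rewrite mulVf // gt_eqF.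
have t0 : 0 < t by rewrite invr_gt0.
have nxi : n%:R `^ xi <= M%:R / 2 :> R.
  have -> : M%:R / 2 = ((M%:R / 2) `^ 4%:R) `^ xi :> R.
    by rewrite -powRrM /xi divff ?powRr1 //; lra.
  apply: ge0_ler_powR; rewrite ?nnegrE ?powR_ge0 ?ler0n ?invr_ge0 //.
  rewrite powR_mulrn; last by lra.
  have : (16 * n)%N%:R <= (M ^ 4)%N%:R :> R by rewrite ler_nat.
  by rewrite natrM natrX expr_div_n => h; lra.
set B := fun y : int => (n%:R `^ xi <= `|y|%:~R)%R%:R : R.
have cB y : 7 / 8 + (- (15 / 8)) * B y <= cos (t * y%:~R).
  rewrite /B; case: (leP (n%:R `^ xi) (`|y|%:~R)) => h /=; rewrite ?mulr1n ?mulr0n.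
    by have := cos_geN1 (t * y%:~R); lra.
  have yM : `|y|%:~R < M%:R / 2 :> R by exact: lt_le_trans h nxi.
  have ty : `|t * y%:~R| <= 1 / 2.
    rewrite normrM (gtr0_norm t0) -intr_norm; nra.
  have : (t * y%:~R) ^+ 2 <= (1 / 2) ^+ 2.
    by rewrite -[leLHS]real_normK ?num_real // lerXn2r ?nnegrE //; lra.
  by have := cos_ge_quadratic (t * y%:~R); lra.
have cm : 7 / 8 + (- (15 / 8)) * walk_mean P delta n B <=
    walk_mean P delta n (fun y => cos (t * y%:~R)).
  rewrite -[X in X + _](walk_mean_cst P delta n) -walk_meanZ -walk_meanD.
  apply: mean_le => [||f]; try exact: ev_bounded_measurable.
  by apply: ev_le => // y _; exact: cB.
rewrite leNgt; apply/negP => h.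
move: cM; rewrite /char_sq.
set a := walk_mean P delta n (fun y => cos (t * y%:~R)) in cm *.
set s := walk_mean _ _ _ _.
have := sqr_ge0 s; nra.
Qed.

Lemma ev_extreme (p : int -> nat -> R) n s x (u : int -> R) :
  (forall y m, 1 / 4 <= p y m <= 1) -> (forall y, 0 <= u y) ->
  1 <= u (x + n%:Z) -> (1 / 4) ^+ n <= ev p n s x u.
Proof.
move=> p4 u0; elim: n s x => [|n IH] s x ux; first by rewrite addr0 in ux.
have /andP[q0 q1] := p4 x s.
have pos m y k : 0 <= ev p m k y u.
  rewrite -(ev_cst p m k y 0); apply: ev_le => // z k'.
  by have /andP[? ?] := p4 z k'; apply/andP; split; lra.
have h1 : (1 / 4) ^+ n <= ev p n s.+1 (x + 1) u.
  by apply: IH; rewrite (_ : x + 1 + n%:Z = x + n.+1%:Z) //; lia.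
have h2 := pos n (x - 1) s.+1.
rewrite exprS /=; have : 0 <= (1 / 4) ^+ n :> R by rewrite exprn_ge0.
nra.
Qed.

End Spread.

Theorem theorem1p2 (R : realType) :
  exists2 c0 : R, 0 < c0 &
  forall (P : probability (field_space R) R) (eps : nat -> nat -> nat -> R),
    translation_invariant P ->
    reflection_invariant P ->
    FKG P ->
    decoupling P eps ->
    (exists2 c1 : R, 0 < c1 &
      forall w h r : nat, (1 <= w)%N -> (1 <= h)%N -> (2 <= r)%N ->
        eps w h r <=
          c1 * (w%:R * h%:R + (w%:R + h%:R) * r%:R + r%:R ^+ 2)
             * r%:R `^ (- c0)) ->
    exists c2 xi : R, [/\ 0 < c2, 0 < xi &
      forall delta : R, 0 <= delta <= 2^-1 -> delta <= c2 ->
      forall (d : measure_display) (Omega : measurableType d)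
        (X : nat -> Omega -> int)
        (Pf : field_space R -> probability Omega R),
        (forall f : field_space R, quenched_walk delta f (Pf f) X) ->
        (0 < ereal_inf
               [set annealed P Pf [set om | (n%:R `^ xi <= `|X n om|%:~R)%R]
                 | n in [set n : nat | (1 <= n)%N]])%E].
Proof.
exists 33%:R => // P eps tr _ _ dec [c1 c10 epsB].
have [G0 G2 GK] : exists2 G0 : nat, (2 <= G0)%N & scale_constant c1 <= G0%:R.
  exists (2 + (Num.truncn (scale_constant c1)).+1)%N; first by rewrite leq_addr.
  rewrite natrD -[leLHS]add0r lerD //.
  by apply: ltW; apply: real_truncnS_gt; exact: num_real.
(* M0 is the first scale and L0, of order M0^2, the time needed to reach it;
   every time n >= L0 has gaps of length g >= G0. *)
pose M0 := (G0 ^ 4 + 32)%N.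
pose L0 := (4 * M0 ^ 2)%N.
have M032 : (32 <= M0)%N by rewrite leq_addl.
have L0_gt0 : (0 < L0)%N by rewrite muln_gt0 expn_gt0 (leq_trans _ M032).
(* With this bound, delta n is at most 1/32 on the whole initial range
   L0 <= n < 16 L0. *)
pose c2 : R := (512 * L0)%N%:R^-1.
have c2_gt0 : 0 < c2 by rewrite invr_gt0 ltr0n muln_gt0.
exists c2, 4^-1; split => //.
move=> delta d01 dc2 d Omega X Pf walk.
have spreadL n : (L0 <= n)%N -> spread P delta n.
  elim/ltn_ind: n => n IH Ln.
  (* The initial range has ratio 16 because a block of n is at least n / 16. *)
  have [nL|Ln16] := ltnP n (16 * L0)%N.
    exists M0; split; first exact: leq_trans M032.
      have : (1024 * M0 ^ 2 <= M0 ^ 4)%N.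
        by rewrite (expnD M0 2 2) leq_mul2r (leq_sqr 32) M032 orbT.
      by rewrite /L0 in nL; lia.
    apply: (@char_sq_base _ P _ d01 M0) => //; first exact: leq_trans M032.
    apply: (@le_trans _ _ (c2 * (16 * L0)%N%:R)).
      by apply: ler_pM => //; [case/andP: d01|rewrite ler_nat ltnW].
    have L0R : 0 < L0%:R :> R by rewrite ltr0n.
    rewrite /c2 (natrM R 16) (natrM R 512) invfM -mulrA (mulrCA _ 16).
    by rewrite mulVf ?gt_eqF //; lra.
  have [g gn] := eighth_root n.
  have G0g : (G0 <= g)%N.
    rewrite -ltnS -(ltn_exp2r _ _ (isT : 0 < 8)%N).
    case/andP: gn => _; apply: leq_ltn_trans; apply: leq_trans Ln.
    rewrite /L0 (expnM G0 4 2).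
    apply: (@leq_trans (M0 ^ 2)%N); last exact: leq_pmull.
    by rewrite leq_sqr leq_addr.
  have g2 := leq_trans G2 G0g.
  have [_ nl _ _ ln] := scale_arith g2 gn.
  apply: (spread_step d01 tr dec c10 epsB g2 _ gn).
    by apply: (le_trans GK); rewrite ler_nat.
  apply: IH => //; lia.
pose kappa : R := Num.min (1 / 16) ((1 / 4) ^+ L0).
have kappa_gt0 : 0 < kappa by rewrite lt_min exprn_gt0 ?andbT; lra.
apply: (@lt_le_trans _ _ kappa%:E); first by rewrite lte_fin.
apply: le_ereal_inf_tmp => _ [n /= n1 <-].
rewrite (annealedE d01 P n (fun y : int => (n%:R `^ 4^-1 <= `|y|%:~R)%R) walk).
rewrite lee_fin /kappa ge_min; apply/orP.
have [Ln|nL] := leqP L0 n; first by left; apply: spread_walk_mean (spreadL n Ln).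
(* For n < L0, the walk goes up n times in a row, each time with probability at
   least 1/2 - delta >= 1/4. *)
right; apply: (@le_trans _ _ ((1 / 4) ^+ n)).
  by apply: ler_wiXn2l; [lra|lra|exact: ltnW].
have c24 : c2 <= 1 / 4.
  have L0R : 1 <= L0%:R :> R by rewrite ler1n.
  have : c2 * (512 * L0%:R) = 1.
    by rewrite /c2 (natrM R 512) mulVf // mulf_neq0 // gt_eqF // ltr0n.
  have : c2 * 1 <= c2 * L0%:R by rewrite ler_wpM2l // ltW.
  lra.
have nR : 1 <= n%:R :> R by rewrite ler1n.
have nxi : n%:R `^ 4^-1 <= n%:R :> R.
  by rewrite -[leRHS](powRr1 (ler0n _ n)) ler_powR //; lra.
have p4 f y m : 1 / 4 <= up_prob delta f y m <= 1.
  move: d01 dc2; rewrite /up_prob => /andP[d0 d1] dc2.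
  by case: (ltgtP (f (y, m%:Z)) 0) => _ /=; rewrite ?mulr1n ?mulr0n;
    apply/andP; split; lra.
rewrite -(walk_mean_cst P delta n ((1 / 4) ^+ n)).
apply: mean_le => [||f]; try exact: ev_bounded_measurable.
rewrite ev_cst; apply: ev_extreme => //.
by rewrite add0r nxi.
Qed.
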